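(* Let $s\in(0,1)$ and $p\in(1,\infty)$ with $sp<n$, and let $\phi:[0,\infty)\to[0,\infty)$ be a measurable function satisfying (Dini), (adec) and (ainc) of the context with constants $s<\tilde s<\infty$ and $L\ge 1$. There is a constant $c=c(n,p,\tilde s,L)>0$ (in particular independent of $s$) such that, if $v\in W^{\phi,p}(B_r)$ for a ball $B_r\subset\mathbb{R}^n$ of radius $r>0$, then $$\left(\frac{1}{|B_r|}\int_{B_r}|v-(v)_{B_r}|^{p_s^*}\,dx\right)^{p/p_s^*}\le\frac{c}{s^p(n-sp)^{p-1}}\,\frac{r^p}{\Phi(r)}\,\frac{1}{|B_r|}\int_{B_r}\int_{B_r}\frac{|v(x)-v(y)|^p}{|x-y|^p}\frac{\phi(|x-y|)}{|x-y|^n}\,dy\,dx,$$ where $p_s^*=np/(n-sp)$.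
   Context: $\phi:[0,\infty)\to[0,\infty)$ is measurable with $\phi(0)=0$ and $\phi(t)>0$ for $t>0$. The conditions are: (Dini) $\int_0^1\phi(t)\,\frac{dt}{t}<\infty$; (adec) $\frac{\phi(t_2)}{t_2^{(1-s)p}}\le L\frac{\phi(t_1)}{t_1^{(1-s)p}}$ for all $0<t_1\le t_2<\infty$; (ainc) $\frac{\phi(t_2)}{t_2^{(1-\tilde s)p}}\ge L^{-1}\frac{\phi(t_1)}{t_1^{(1-\tilde s)p}}$ for all $0<t_1\le t_2<\infty$. $\Phi(0)=0$ and $\Phi(t)=\int_0^t\phi(\tau)\frac{d\tau}{\tau}$ for $t>0$. For an open set $U\subseteq\mathbb{R}^n$, $W^{\phi,p}(U)$ is the set of $f\in L^p(U)$ with $\int_U\int_U\frac{|f(x)-f(y)|^p}{|x-y|^p}\frac{\phi(|x-y|)}{|x-y|^n}\,dy\,dx<\infty$. $(v)_{B}=\frac{1}{|B|}\int_B v\,dx$. *)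

(* Defs.v *)
From HB Require Import structures.
From mathcomp Require Import all_boot all_order all_algebra.
From mathcomp Require Import all_classical all_reals all_analysis.
From mathcomp Require Import measurable_realfun.

Set Implicit Arguments.
Unset Strict Implicit.
Unset Printing Implicit Defensive.
Import Order.TTheory GRing.Theory Num.Theory.
Import numFieldNormedType.Exports.

Local Open Scope classical_set_scope.
Local Open Scope ring_scope.

(* R^n is [n.-tuple R] with its product (Borel) sigma-algebra; its Lebesgue
   measure is obtained by iterating the binary product measure. *)
Section cons_measure.
Context {R : realType} {n : nat}.

Definition tuple_cons (z : measurableTypeR R * n.-tuple R) : n.+1.-tuple R :=
  [the n.+1.-tuple R of z.1 :: z.2].

Definition tuple_uncons (x : n.+1.-tuple R) : measurableTypeR R * n.-tuple R :=
  (thead x, [tuple of behead x]).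

Lemma tuple_consK : cancel tuple_cons tuple_uncons.
Proof.
by move=> [a b]; rewrite /tuple_uncons /tuple_cons/= theadE; congr pair; exact/val_inj.
Qed.

Lemma measurable_tuple_cons : measurable_fun setT tuple_cons.
Proof.
apply: (@measurable_cons _ _ _ R fst n snd).
  exact: (@measurable_fst _ _ (measurableTypeR R) (n.-tuple R)).
exact: measurable_snd.
Qed.

Lemma measurable_tuple_uncons : measurable_fun setT tuple_uncons.
Proof.
apply/measurable_fun_pair.
  exact: (@measurable_tnth _ R n.+1 ord0).
exact: (@measurable_behead _ R n).
Qed.

Variable mu : {sigma_finite_measure set (n.-tuple R) -> \bar R}.

Definition cons_measure : set (n.+1.-tuple R) -> \bar R :=
  pushforward (lebesgue_measure \x mu)%E tuple_cons.

Let cons_measure0 : cons_measure set0 = 0%E.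
Proof. by rewrite /cons_measure /pushforward preimage_set0 measure0. Qed.

Let cons_measure_ge0 A : (0 <= cons_measure A)%E.
Proof. by rewrite /cons_measure /pushforward; exact: measure_ge0. Qed.

Let cons_measure_sigma_additive : semi_sigma_additive cons_measure.
Proof.
exact: (@measure_semi_sigma_additive _ _ _
  (measure_function_pushforward__canonical__measure_function_Measure
    (lebesgue_measure \x mu)%E measurable_tuple_cons)).
Qed.

HB.instance Definition _ := isMeasure.Build _ _ _ cons_measure
  cons_measure0 cons_measure_ge0 cons_measure_sigma_additive.

Let cons_measure_sigma_finite : sigma_finite setT cons_measure.
Proof.
have /sigma_finiteP[F [TF ndF Foo]] := sigma_finiteT (@lebesgue_measure R).
have /sigma_finiteP[G [TG ndG Goo]] := sigma_finiteT mu.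
exists (fun k => tuple_uncons @^-1` (F k `*` G k)).
  apply/seteqP; split => // x _.
  have [j _ Fj] : (\bigcup_k F k) (thead x) by rewrite -TF.
  have [k _ Gk] : (\bigcup_k G k) [tuple of behead x] by rewrite -TG.
  exists (maxn j k) => //; split => /=.
  - by move: Fj; exact/subsetPset/ndF/leq_maxl.
  - by move: Gk; exact/subsetPset/ndG/leq_maxr.
move=> k; have [mF F_oo] := Foo k; have [mG G_oo] := Goo k; split.
  rewrite -[X in measurable X]setTI; apply: measurable_tuple_uncons => //.
  exact: measurableX.
rewrite /cons_measure /pushforward -comp_preimage.
rewrite (_ : _ \o _ = id); last by apply/funext => z /=; rewrite tuple_consK.
by rewrite preimage_id product_measure1E// lte_mul_pinfty// ge0_fin_numE.
Qed.

HB.instance Definition _ :=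
  Measure_isSigmaFinite.Build _ _ _ cons_measure cons_measure_sigma_finite.

End cons_measure.

Fixpoint leb {R : realType} (n : nat) :
    {sigma_finite_measure set (n.-tuple R) -> \bar R} :=
  match n with
  | 0 => [the {sigma_finite_measure set (0.-tuple R) -> \bar R} of
           \d_([tuple] : 0.-tuple R)]
  | m.+1 => [the {sigma_finite_measure set (m.+1.-tuple R) -> \bar R} of
              cons_measure (leb m)]
  end.

Lemma leb_box {R : realType} (n : nat) (A : 'I_n -> set R) :
  (forall i, measurable (A i)) ->
  leb n [set x | forall i, A i (tnth x i)] =
    (\prod_(i < n) lebesgue_measure (A i))%E.
Proof.
elim: n A => [|n IH] A mA.
  rewrite big_ord0 /= diracE mem_set//; by case.
rewrite big_ord_recl /= /cons_measure /pushforward.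
pose A' i := A (lift ord0 i).
have mbox : measurable [set x : n.-tuple R | forall i, A' i (tnth x i)].
  rewrite (_ : mkset _ =
      \bigcap_(i in [set: 'I_n]) ((@tnth _ R ^~ i) @^-1` A' i)); last first.
    by apply/seteqP; split => x /= xA i => [_|]; exact: xA.
  apply: fin_bigcap_measurable => // i _; rewrite -[X in measurable X]setTI.
  by apply: measurable_tnth => //; exact: mA.
rewrite -IH; last by move=> i; exact: mA.
rewrite -product_measure1E//; last exact: mA.
congr (_ _); apply/seteqP; split => [[a b] /= ab|[a b] /= [Aa Ab] i].
  by split=> [|i]; [exact: (ab ord0)|have := ab (lift ord0 i); rewrite tnthS].
by have [j ->|->//] := unliftP ord0 i; rewrite tnthS; exact: Ab.
Qed.

(* [measurable] only refers to Borel sets, so Lebesgue measurability is expressed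
   with the completed sigma-algebra. The integrals below are still taken against
   the Borel measures [lebesgue_measure] and [leb n]: since [\int] of a nonnegative
   function is the supremum of the integrals of the simple functions below it, it
   agrees with the usual Lebesgue integral on Lebesgue measurable functions. *)
Definition lebesgue_measurable_fun d (T : measurableType d) (R : realType)
    (mu : set T -> \bar R) (D : set T) (f : T -> R) : Prop :=
  forall Y : set R, measurable Y -> completed_algebra_gen mu (D `&` f @^-1` Y).

Section weights.
Context {R : realType}.
Implicit Types (phi : R -> R) (s st p L : R).

(* A function [0, oo[ -> [0, oo[ is represented by a function R -> R whose values
   at negative arguments are never used. *)
Definition weight phi : Prop :=
  [/\ lebesgue_measurable_fun (@lebesgue_measure R) `[0, +oo[ phi,
      phi 0 = 0 & forall t, 0 < t -> 0 < phi t].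

Definition Dini phi : Prop :=
  (\int[lebesgue_measure]_(t in `]0%R, 1%R[) (phi t / t)%:E < +oo)%E.

Definition adec s p L phi : Prop := forall t1 t2, 0 < t1 -> t1 <= t2 ->
  phi t2 / t2 `^ ((1 - s) * p) <= L * (phi t1 / t1 `^ ((1 - s) * p)).

Definition ainc st p L phi : Prop := forall t1 t2, 0 < t1 -> t1 <= t2 ->
  phi t2 / t2 `^ ((1 - st) * p) >= L^-1 * (phi t1 / t1 `^ ((1 - st) * p)).

(* Real-valued integral: it is finite as soon as [Dini phi] and [adec s p L phi]
   hold, and [Phi phi 0 = 0] because the domain of integration is empty. *)
Definition Phi phi (t : R) : R :=
  \int[lebesgue_measure]_(tau in `]0, t[) (phi tau / tau).

End weights.

Section sobolev.
Context {R : realType} {n : nat}.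
Implicit Types (x y : n.-tuple R) (U : set (n.-tuple R)) (phi : R -> R) (p : R).

Definition edist x y : R :=
  Num.sqrt (\sum_(i < n) (tnth x i - tnth y i) ^+ 2).

Definition eball x (r : R) : set (n.-tuple R) := [set y | edist x y < r].

Definition Lp U p (f : n.-tuple R -> R) : Prop :=
  lebesgue_measurable_fun (leb n) U f /\
  (\int[leb n]_(x in U) (`|f x| `^ p)%:E < +oo)%E.

(* On the (null) diagonal the integrand is 0, since division by 0 yields 0. *)
Definition energy phi p U (f : n.-tuple R -> R) : \bar R :=
  (\int[leb n]_(x in U) \int[leb n]_(y in U)
     (`|f x - f y| `^ p / edist x y `^ p *
      (phi (edist x y) / edist x y ^+ n))%:E)%E.

Definition W phi p U (f : n.-tuple R -> R) : Prop :=
  Lp U p f /\ (energy phi p U f < +oo)%E.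

Definition vol U : R := fine (leb n U).

Definition mean U (f : n.-tuple R -> R) : R :=
  (vol U)^-1 * \int[leb n]_(x in U) f x.

End sobolev.

(* Main.v *)
From mathcomp Require Import all_boot all_order all_algebra.
From mathcomp Require Import all_classical all_reals all_analysis.
From mathcomp Require Import measurable_realfun ring lra.
Require Import Defs.

(** Large values of [v] force oscillation at a scale dictated by the measure of
    the set where they are attained, and oscillation at one scale forces at least
    as much oscillation at every smaller scale.

    Write B for the ball, V for its volume, eps = n - s p, q = n p / eps for the
    Sobolev exponent, tau_k = 2^(1-k) r, and

      J_k(T) = int_B int_B |T x - T y|^p [|x - y| < tau_k] dy dx.

    For x, y in B the midpoint is in B, so |T x - T y| splits there
    into two differences at half the distance; a change of variables gives
    J_k <= 2^(n+p) J_(k+1) ([kenergy_double]). The constant is exactly the ratio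
    of tau_k^(n+p) to tau_(k+1)^(n+p), so that tau_k^(-n-p) J_k is nondecreasing
    in k without any loss. The energy of [v] dominates the sum over k of
    phi(tau_k) tau_k^(-n-p) J_k ([multiscale_le]), hence it dominates
    tau_i^(-n-p) J_i times the tail of the sum of the phi(tau_k) from k = i on.
    By (adec) this tail is at least 2^(-i(1-s)p) / L times the whole sum
    ([phi_tauD]), and the whole sum controls Phi(r) ([Phi_bound]). This is where
    the factor 1 / Phi(r) comes from.

    Let now u >= 0 vanish on half of B, let t_i be the level that u exceeds
    on a set of measure 2^(-in) V / 2, and let T_i be the truncation of u between
    t_i and t_(i+1). Around a point x where u >= t_(i+1), the homothetic copy
    x + 2^(-i) (B - x) of B stays in B, has measure 2^(-in) V and diameter at most
    tau_i; on at least half of it u <= t_i. So J_i(T_i) is at least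
    (t_(i+1) - t_i)^p times known measures ([level_lower_bound]). Since the
    energies of the T_i add up to at most that of u ([sum_trunc_powR]), the sum of
    2^(-i eps) (t_(i+1) - t_i)^p is at most X = const r^p / Phi(r) times the
    normalised energy ([level_energy]).

    With theta = 2^(-eps/p) one has theta^q = 2^(-n), so the L^q norm
    of u is controlled by the sum of (theta^i t_(i+1))^q, and a discrete Hardy
    inequality ([discrete_hardy]) bounds it by
    ((1 - theta)^(1-p) X)^(q/p) / (1 - theta). As 1 - theta is at least a multiple
    of eps, the power p/q = eps/n of this bound is at most a multiple of
    eps^(1-p) X: the remaining factor (1 - theta)^(-eps/n) is bounded
    ([sobolev_const_bound]). The factor s^(-p) of the statement is at least 1.

    The theorem follows on applying this to the positive parts of [v] above and
    below its medians ([median_Lq]), and then replacing the median by the mean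
    ([mean_Lq]). As [v] and phi are only Lebesgue measurable, [v] is replaced by a
    Borel representative ([borel_representative]) and phi enters only through
    comparisons with its values at the tau_k. *)

Set Implicit Arguments.
Unset Strict Implicit.
Unset Printing Implicit Defensive.
Import Order.TTheory GRing.Theory Num.Theory.
Import numFieldNormedType.Exports HBNNSimple.

Local Open Scope classical_set_scope.
Local Open Scope ring_scope.

(** * Integrals of arbitrary functions and exceptional null sets *)

Section integral_without_measurability.
Context d (T : measurableType d) (R : realType).
Variable mu : {measure set T -> \bar R}.
Local Open Scope ereal_scope.

(** An integral of a nonnegative function is a supremum over the simple functions
    below it, so it is monotone even without measurability. This is needed because
    the weight is not assumed to be Borel. *)
Lemma le_integral_nomeas (D : set T) (f g : T -> \bar R) :
  (forall x, D x -> 0 <= f x) -> (forall x, D x -> f x <= g x) ->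
  \int[mu]_(x in D) f x <= \int[mu]_(x in D) g x.
Proof.
move=> f0 fg.
rewrite !ge0_integralE//; last by move=> x Dx; exact: le_trans (f0 x Dx) (fg x Dx).
apply: ge_ereal_sup => _ [h /= hf <-]; apply: ereal_sup_ubound; exists h => //= x.
apply: le_trans (hf x) _; rewrite !patchE; case: ifPn => // /set_mem; exact: fg.
Qed.

(** A simple function below [f] becomes a simple function below [g] with the same
    integral once it is cut off on the null set [N]. *)
Lemma ge0_eq_integral_off_null (D N : set T) (f g : T -> \bar R) :
  measurable N -> mu N = 0 ->
  (forall x, D x -> 0 <= f x) -> (forall x, D x -> 0 <= g x) ->
  (forall x, D x -> ~ N x -> f x = g x) ->
  \int[mu]_(x in D) f x = \int[mu]_(x in D) g x.
Proof.
move=> mN N0.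
suff le f1 f2 : (forall x, D x -> 0 <= f1 x) -> (forall x, D x -> 0 <= f2 x) ->
    (forall x, D x -> ~ N x -> f1 x = f2 x) ->
    \int[mu]_(x in D) f1 x <= \int[mu]_(x in D) f2 x.
  by move=> f0 g0 fg; apply/eqP; rewrite eq_le !le// => x Dx Nx; rewrite fg.
move=> f10 f20 f12; rewrite !ge0_integralE//.
apply: ge_ereal_sup => _ [h /= hf <-].
have mCN : measurable (~` N) by exact: measurableC.
apply: ereal_sup_ubound; exists (proj_nnsfun h mCN) => /=.
  move=> x; rewrite mindicE.
  have [/set_mem Nx|/negP Nx] := boolP (x \in ~` N); last first.
    by rewrite mulr0 patchE; case: ifPn => // /set_mem; exact: f20.
  rewrite mulr1 (le_trans (hf x))// !patchE; case: ifPn => // /set_mem Dx.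
  by rewrite f12.
rewrite -!integralT_nnsfun; apply: ge0_ae_eq_integral => //.
- exact/measurable_EFinP/measurable_funP.
- exact/measurable_EFinP/measurable_funP.
- by move=> x _; rewrite lee_fin; exact: fun_ge0.
- by move=> x _; rewrite lee_fin; exact: fun_ge0.
exists N; split => // x /= /not_implyP[_]; apply: contra_notP => Nx.
by rewrite mindicE mem_set// mulr1.
Qed.

Lemma eq_integral_off_null (D N : set T) (f g : T -> \bar R) :
  measurable N -> mu N = 0 -> (forall x, D x -> ~ N x -> f x = g x) ->
  \int[mu]_(x in D) f x = \int[mu]_(x in D) g x.
Proof.
move=> mN N0 fg; rewrite integralE [RHS]integralE; congr (_ - _);
  by apply: (ge0_eq_integral_off_null mN N0) => // x Dx Nx;
    rewrite ?funeposE ?funenegE fg.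
Qed.

(** Each set [v > q] with [q] rational differs from a Borel set by a subset of a
    null Borel set; off the countable union of these null sets [v] is Borel. *)
Lemma borel_representative (D : set T) (v : T -> R) :
  measurable D -> lebesgue_measurable_fun mu D v ->
  exists N (w : T -> R), [/\ measurable N, mu N = 0, measurable_fun setT w &
    forall x, D x -> ~ N x -> v x = w x].
Proof.
move=> mD mv.
pose q k : rat := odflt 0%R (unpickle k).
have H k : exists AM : set T * set T, [/\ measurable AM.1, measurable AM.2,
    mu AM.2 = 0 & forall x, ~ AM.2 x ->
      AM.1 x <-> D x /\ (ratr (q k) < v x)%R].
  have [A mA [M [M' [mM' M'0 MM']] AM]] :=
    mv `](ratr (q k) : R), +oo[%classic (measurable_itv _).
  exists (A, M'); split => //= x nM'x; split => [Ax|[Dx vx]].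
    have : (A `|` M) x by left.
    by rewrite AM => -[Dx]; rewrite /= in_itv/= andbT.
  have : (D `&` v @^-1` `](ratr (q k) : R), +oo[%classic) x.
    by split => //=; rewrite in_itv/= andbT.
  by rewrite -AM => -[//|/MM'].
have [AM AMP] := choice H.
pose N := \bigcup_k (AM k).2.
have mN : measurable N by apply: bigcupT_measurable => k; have [] := AMP k.
have N0 : mu N = 0.
  apply/negligibleP => //; apply: negligible_bigcup => k.
  by have [_ ? ? _] := AMP k; exact/negligibleP.
have mDN : measurable (D `\` N) by exact: measurableD.
have mvDN : measurable_fun (D `\` N) v.
  move=> _; apply: (measurability _ (RGenOInfty.measurableE R)) => //.
  move=> /= _ [_ [a ->] <-]; rewrite preimage_itvoy.
  rewrite [X in measurable X](_ : _ = (D `\` N) `&`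
    \bigcup_k (if (a < ratr (q k))%R then (AM k).1 else set0)).
    apply: measurableI => //; apply: bigcupT_measurable => k.
    by case: ifPn => // _; have [] := AMP k.
  apply/seteqP; split => x /= [[Dx Nx]].
    move=> /rat_in_itvoo[r]; rewrite inE /= => /itvP h; split => //.
    have qr : q (pickle r) = r by rewrite /q pickleK.
    exists (pickle r) => //; rewrite qr h; have [_ _ _ P] := AMP (pickle r).
    by apply/P; [move=> ?; apply: Nx; exists (pickle r)|rewrite qr h].
  move=> [k _]; case: ifPn => // ak Akx; split => //.
  have [_ _ _ P] := AMP k; have [//|_ qv] := (P x _).1 Akx.
    by move=> ?; apply: Nx; exists k.
  exact: lt_trans ak qv.
exists N, (patch (fun=> 0%R) (D `\` N) v); split => //.
  exact/(measurable_restrictT _ _).1.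
by move=> x Dx Nx; rewrite patchE mem_set.
Qed.

End integral_without_measurability.

(** * Affine changes of variables for the Lebesgue measure *)

Section affine_change_of_variables.
Context {R : realType}.
Implicit Types (a c : R) (n : nat).
Local Open Scope ereal_scope.

Definition affR c a (z : measurableTypeR R) : measurableTypeR R := (c + a * z)%R.

Lemma measurable_affR c a : measurable_fun setT (affR c a).
Proof. by apply: measurable_funD => //; exact: measurable_funM. Qed.

(** Both sides are measures in [A] that agree on half-open intervals. *)
Lemma lebesgue_measure_affR c a (A : set (measurableTypeR R)) : (0 < a)%R ->
  measurable A -> lebesgue_measure (affR c a @^-1` A) = (a^-1)%:E * lebesgue_measure A.
Proof.
move=> a0 mA.
have a0' : (0 <= a)%R by exact: ltW.
pose f : {measure set (measurableTypeR R) -> \bar R} :=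
  measure_function_pushforward__canonical__measure_function_Measure
    lebesgue_measure (measurable_affR c a).
pose m : {measure set (measurableTypeR R) -> \bar R} :=
  mscale (NngNum a0') f.
have E X : m X = a%:E * lebesgue_measure (affR c a @^-1` X) by [].
suff -> : lebesgue_measure A = m A.
  by rewrite E muleA -EFinM mulVf ?gt_eqF// mul1e.
apply: lebesgue_measure_unique => // _ [[u v] _ <-]; rewrite E.
rewrite (_ : affR c a @^-1` _ = `]((u - c) / a)%R, ((v - c) / a)%R]%classic); last first.
  apply/seteqP; split => x; rewrite /= /affR !in_itv/= ltr_pdivrMr// ler_pdivlMr//;
    by rewrite ltrBlDl lerBrDl (mulrC x).
rewrite !lebesgue_measure_itv/= !lte_fin ltr_pM2r ?invr_gt0// ltrD2r.
case: ifPn => _; last by rewrite mule0.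
rewrite -!EFinD -EFinM; congr EFin.
by rewrite -mulrBl mulrCA divff ?gt_eqF// mulr1 opprB addrA subrK.
Qed.

Lemma ge0_integral_affR c a (f : measurableTypeR R -> \bar R) : (0 < a)%R ->
  measurable_fun setT f -> (forall x, 0 <= f x) ->
  \int[lebesgue_measure]_z f (affR c a z) = (a^-1)%:E * \int[lebesgue_measure]_z f z.
Proof.
move=> a0 mf f0.
have a0' : (0 <= a^-1)%R by rewrite invr_ge0 ltW.
transitivity (\int[pushforward lebesgue_measure (affR c a)]_z f z).
  by rewrite (ge0_integral_pushforward (measurable_affR c a)).
rewrite -(ge0_integral_mscale lebesgue_measure measurableT (NngNum a0'))//.
apply: eq_measure_integral; first exact: measurable_affR.
by move=> mf' A mA _; exact: lebesgue_measure_affR.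
Qed.

Definition aff {n} (c : n.-tuple R) a (y : n.-tuple R) : n.-tuple R :=
  [tuple (tnth c i + a * tnth y i)%R | i < n].

Lemma tnth_aff n (c : n.-tuple R) a y i :
  tnth (aff c a y) i = (tnth c i + a * tnth y i)%R.
Proof. by rewrite tnth_mktuple. Qed.

Lemma measurable_aff n (c : n.-tuple R) a : measurable_fun setT (aff c a).
Proof.
apply/measurable_fun_tnthP => i.
rewrite (_ : _ \o _ = fun y => (tnth c i + a * tnth y i)%R); last first.
  by apply/funext => y /=; rewrite tnth_aff.
by apply: measurable_funD => //; apply: measurable_funM => //; exact: measurable_tnth.
Qed.

Lemma aff_cons n (c : n.+1.-tuple R) a z (t : n.-tuple R) :
  aff c a (tuple_cons (z, t)) =
  tuple_cons (affR (thead c) a z, aff [tuple of behead c] a t).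
Proof.
apply: eq_from_tnth => i; rewrite tnth_aff.
have [j ->|->] := unliftP ord0 i.
  rewrite /tuple_cons /= tnthS (tnthS (affR _ _ _)) tnth_aff.
  by congr (_ + _)%R; rewrite {1}(tuple_eta c) tnthS.
by [].
Qed.

(** Induction on the dimension: slicing along the first coordinate reduces the
    scaling of the (n+1)-dimensional measure to that of its slices and to the
    one-dimensional change of variables. *)
Lemma leb_aff n (c : n.-tuple R) a (A : set (n.-tuple R)) : (0 < a)%R ->
  measurable A -> leb n (aff c a @^-1` A) = ((a^-1) ^+ n)%:E * leb n A.
Proof.
move=> a0; elim: n c A => [|n IH] c A mA.
  by rewrite expr0 mul1e /= !diracE; congr (_%:R%:E); congr (nat_of_bool (_ \in _));
    apply/seteqP; split => x /=; rewrite (tuple0 x) (tuple0 (aff _ _ _)).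
pose P := tuple_cons @^-1` A.
have mP : measurable P.
  by rewrite -[P]setTI; exact: measurable_tuple_cons.
have mxs z : measurable (xsection P z) by exact: measurable_xsection.
rewrite /= /cons_measure /pushforward /product_measure1 -/P.
pose g z := leb n (xsection P z).
rewrite (_ : _ \o _ = fun z => ((a^-1) ^+ n)%:E * g (affR (thead c) a z)); last first.
  apply/funext => z /=; rewrite /g -(IH [tuple of behead c])//; congr (leb n _).
  by apply/seteqP; split => t; rewrite /xsection/= !inE /P/= aff_cons.
have mg : measurable_fun setT g by exact: measurable_fun_xsection.
have an0 : (0 <= (a^-1) ^+ n)%R by rewrite exprn_ge0// invr_ge0 ltW.
rewrite ge0_integralZl//; last first.
  by apply: measurableT_comp => //; exact: measurable_affR.
by rewrite ge0_integral_affR// muleA -EFinM exprS mulrC.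
Qed.

Lemma ge0_integral_aff n (c : n.-tuple R) a (f : n.-tuple R -> \bar R) : (0 < a)%R ->
  measurable_fun setT f -> (forall x, 0 <= f x) ->
  \int[leb n]_y f (aff c a y) = ((a^-1) ^+ n)%:E * \int[leb n]_y f y.
Proof.
move=> a0 mf f0.
have a0' : (0 <= (a^-1) ^+ n)%R by rewrite exprn_ge0// invr_ge0 ltW.
transitivity (\int[pushforward (leb n) (aff c a)]_z f z).
  by rewrite (ge0_integral_pushforward (measurable_aff c a)).
rewrite -(ge0_integral_mscale (leb n) measurableT (NngNum a0'))//.
apply: eq_measure_integral; first exact: measurable_aff.
by move=> mf' A mA _; exact: leb_aff.
Qed.

End affine_change_of_variables.

(** * Euclidean balls and double integrals *)

Section euclidean_ball.
Context {R : realType} {n : nat}.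
Implicit Types (x y z : n.-tuple R) (a r : R).

Lemma edist_ge0 x y : 0 <= edist x y.
Proof. exact: sqrtr_ge0. Qed.

Lemma edistC x y : edist x y = edist y x.
Proof. by congr Num.sqrt; apply: eq_bigr => i _; rewrite -sqrrN opprB. Qed.

Lemma sum_sqr_ge0 (f : 'I_n -> R) : 0 <= \sum_(i < n) f i ^+ 2.
Proof. by apply: sumr_ge0 => i _; exact: sqr_ge0. Qed.

Lemma edist_ltE x y r : 0 < r ->
  (edist x y < r) = (\sum_(i < n) (tnth x i - tnth y i) ^+ 2 < r ^+ 2).
Proof.
move=> r0; rewrite -[LHS](@ltr_pXn2r _ 2)// ?nnegrE ?edist_ge0 ?(ltW r0)//.
by rewrite sqr_sqrtr// sum_sqr_ge0.
Qed.

(** The point that divides the segment from [x] to [y] in the ratio [a] to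
    [1 - a]; written with [aff] so that the change of variables in [y] applies. *)
Definition seg a x y : n.-tuple R := aff [tuple (1 - a) * tnth x i | i < n] a y.

Lemma tnth_seg a x y i : tnth (seg a x y) i = (1 - a) * tnth x i + a * tnth y i.
Proof. by rewrite tnth_aff tnth_mktuple. Qed.

Lemma edist_seg a x y : 0 <= a -> edist x (seg a x y) = a * edist x y.
Proof.
move=> a0; rewrite -{2}(ger0_norm a0) -sqrtr_sqr -sqrtrM ?sqr_ge0// mulr_sumr.
congr Num.sqrt; apply: eq_bigr => i _; rewrite tnth_seg; ring.
Qed.

Lemma seg_half x y : seg 2^-1 x y = seg 2^-1 y x.
Proof. by apply: eq_from_tnth => i; rewrite !tnth_seg; field. Qed.

Lemma segK a x y : a != 0 -> seg a^-1 x (seg a x y) = y.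
Proof. by move=> a0; apply: eq_from_tnth => i; rewrite !tnth_seg; field. Qed.

(** Convexity of the square, coordinate by coordinate. *)
Lemma eball_convex a x0 r x y : 0 < r -> 0 <= a <= 1 ->
  eball x0 r x -> eball x0 r y -> eball x0 r (seg a x y).
Proof.
move=> r0 /andP[a0 a1]; rewrite /eball/= !edist_ltE// => xB yB.
apply: (@le_lt_trans _ _ ((1 - a) * (\sum_(i < n) (tnth x0 i - tnth x i) ^+ 2) +
   a * (\sum_(i < n) (tnth x0 i - tnth y i) ^+ 2))).
  rewrite !mulr_sumr -big_split/=; apply: ler_sum => i _; rewrite tnth_seg.
  set b := tnth x0 i; set c := tnth x i; set d := tnth y i.
  have : 0 <= a * (1 - a) * (c - d) ^+ 2.
    by apply: mulr_ge0; [apply: mulr_ge0 => //; rewrite subr_ge0|exact: sqr_ge0].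
  nra.
move: xB yB; set P := \sum_(i < n) _; set Q := \sum_(i < n) _ => Pr Qr.
have [PQ|QP] := leP P Q.
  apply: le_lt_trans Qr; have := mulr_ge0 (_ : 0 <= 1 - a) (_ : 0 <= Q - P).
  by rewrite !subr_ge0 => /(_ a1 PQ); lra.
by apply: le_lt_trans Pr; have := mulr_ge0 a0 (_ : 0 <= P - Q);
  rewrite subr_ge0 => /(_ (ltW QP)); lra.
Qed.

(** The parallelogram inequality, coordinate by coordinate. *)
Lemma eball_edist x0 r x y : 0 < r -> eball x0 r x -> eball x0 r y ->
  edist x y < 2 * r.
Proof.
move=> r0; rewrite /eball/= !edist_ltE// ?mulr_gt0// => xB yB.
apply: (@le_lt_trans _ _ (2 * (\sum_(i < n) (tnth x0 i - tnth x i) ^+ 2) +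
   2 * (\sum_(i < n) (tnth x0 i - tnth y i) ^+ 2))); last by nra.
rewrite !mulr_sumr -big_split/=; apply: ler_sum => i _.
set b := tnth x0 i; set c := tnth x i; set d := tnth y i.
have := sqr_ge0 (2 * b - c - d); nra.
Qed.

Lemma measurable_edist d (T : measurableType d) (f g : T -> n.-tuple R) :
  measurable_fun setT f -> measurable_fun setT g ->
  measurable_fun setT (fun t => edist (f t) (g t)).
Proof.
move=> mf mg; apply: (@measurableT_comp _ _ _ _ _ _ (@Num.sqrt R)).
  by apply: continuous_measurable_fun; exact: sqrt_continuous.
apply: measurable_sum => i; apply: measurable_funX; apply: measurable_funB;
  by apply: (measurableT_comp (@measurable_tnth _ _ _ i)).
Qed.

Lemma measurable_eball x0 r : measurable (eball x0 r).
Proof.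
rewrite /eball -[X in measurable X]setTI; under eq_set do rewrite -lte_fin.
apply: measurable_lte => //; apply/measurable_EFinP => //.
by apply: measurable_edist => //; exact: measurable_cst.
Qed.

Definition cube x0 (h : R) : set (n.-tuple R) :=
  [set x | forall i, `](tnth x0 i - h), (tnth x0 i + h)[%classic (tnth x i)].

Lemma measurable_cube x0 h : measurable (cube x0 h).
Proof.
rewrite (_ : cube x0 h = \bigcap_(i in [set: 'I_n])
    ((@tnth _ R ^~ i) @^-1` `](tnth x0 i - h), (tnth x0 i + h)[)); last first.
  by apply/seteqP; split => x /= xA i => [_|]; exact: xA.
apply: fin_bigcap_measurable => // i _; rewrite -[X in measurable X]setTI.
by apply: measurable_tnth => //; exact: measurable_itv.
Qed.

Lemma leb_cube x0 h : 0 < h -> leb n (cube x0 h) = ((2 * h) ^+ n)%:E.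
Proof.
move=> h0.
rewrite [LHS](leb_box (A := fun i => `](tnth x0 i - h), (tnth x0 i + h)[%classic));
  last by move=> i; exact: measurable_itv.
rewrite (eq_bigr (fun=> (2 * h)%:E)); first by rewrite prodEFin prodr_const card_ord.
move=> i _; rewrite lebesgue_measure_itv/= lte_fin ifT; last by lra.
by rewrite -EFinD; congr EFin; ring.
Qed.

Lemma leb_eball_lty x0 r : 0 < r -> (leb n (eball x0 r) < +oo)%E.
Proof.
move=> r0; apply: (@le_lt_trans _ _ (leb n (cube x0 r))); last first.
  by rewrite leb_cube// ltry.
apply: le_measure; rewrite ?inE; [exact: measurable_eball|exact: measurable_cube|].
move=> y; rewrite /eball/= edist_ltE// => yB i; rewrite /= in_itv/=.
have : (tnth x0 i - tnth y i) ^+ 2 < r ^+ 2.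
  apply: le_lt_trans yB; rewrite (bigD1 i)//= lerDl.
  by apply: sumr_ge0 => j _; exact: sqr_ge0.
move=> H; have : `|tnth x0 i - tnth y i| < r.
  by rewrite -(@ltr_pXn2r _ 2)// ?nnegrE ?(ltW r0)// real_normK// num_real.
by rewrite ltr_norml => /andP[? ?]; apply/andP; split; lra.
Qed.

Lemma leb_eball_ge x0 r : (0 < n)%N -> 0 < r ->
  (((2 * (r / n%:R)) ^+ n)%:E <= leb n (eball x0 r))%E.
Proof.
move=> n0 r0; have n0' : 0 < n%:R :> R by rewrite ltr0n.
have rn : 0 < r / n%:R by rewrite divr_gt0.
rewrite -(leb_cube x0 rn).
apply: le_measure; rewrite ?inE; [exact: measurable_cube|exact: measurable_eball|].
move=> y /= yA; rewrite /eball/= edist_ltE//.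
apply: (@lt_le_trans _ _ (\sum_(i < n) (r / n%:R) ^+ 2)).
  apply: ltr_sum; first by apply/hasP; exists (Ordinal n0); rewrite ?mem_index_enum.
  move=> i _; have := yA i; rewrite /= in_itv/= => /andP[? ?]; nra.
rewrite sumr_const card_ord -[leLHS]mulr_natl.
have -> : n%:R * (r / n%:R) ^+ 2 = r ^+ 2 * n%:R^-1 by field; rewrite gt_eqF.
rewrite ler_piMr ?sqr_ge0//.
by rewrite invf_le1// ler1n.
Qed.

End euclidean_ball.

Section double_integral.
Context d (T : measurableType d) (R : realType).
Variable mu : {sigma_finite_measure set T -> \bar R}.
Implicit Types f g : T -> T -> R.
Local Open Scope ereal_scope.

Definition dint f : \bar R := \int[mu]_x \int[mu]_y (f x y)%:E.

Definition mfun2 f := measurable_fun setT (fun z : T * T => f z.1 z.2).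

Lemma mfun2_swap f : mfun2 f -> mfun2 (fun x y => f y x).
Proof.
by move=> mf; exact: (measurableT_comp mf (measurable_swap (T1 := T) (T2 := T))).
Qed.

Lemma measurable_mfun2 f x : mfun2 f -> measurable_fun setT (fun y => (f x y)%:E).
Proof.
move=> mf; apply/measurable_EFinP.
exact: (measurableT_comp mf (pair1_measurable x)).
Qed.

Lemma measurable_int_mfun2 f : (forall x y, 0 <= f x y)%R -> mfun2 f ->
  measurable_fun setT (fun x => \int[mu]_y (f x y)%:E).
Proof.
move=> f0 mf.
apply: (measurable_fun_fubini_tonelli_F (fun z : T * T => (f z.1 z.2)%:E)).
- exact/measurable_EFinP.
- by move=> z; rewrite lee_fin.
Qed.

Lemma dintC f : (forall x y, 0 <= f x y)%R -> mfun2 f ->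
  dint f = dint (fun x y => f y x).
Proof.
move=> f0 mf.
apply: (@fubini_tonelli _ _ _ _ _ mu mu (fun z : T * T => (f z.1 z.2)%:E)).
- exact/measurable_EFinP.
- by move=> z; rewrite lee_fin.
Qed.

Lemma le_dint f g : (forall x y, 0 <= f x y)%R -> (forall x y, f x y <= g x y)%R ->
  dint f <= dint g.
Proof.
move=> f0 fg; apply: le_integral_nomeas => x _.
  by apply: integral_ge0 => y _; rewrite lee_fin.
by apply: le_integral_nomeas => y _; rewrite lee_fin.
Qed.

Lemma dint_ge0 f : (forall x y, 0 <= f x y)%R -> 0 <= dint f.
Proof.
by move=> f0; apply: integral_ge0 => x _; apply: integral_ge0 => y _; rewrite lee_fin.
Qed.

Lemma dintZ (k : R) f : (0 <= k)%R -> (forall x y, 0 <= f x y)%R -> mfun2 f ->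
  dint (fun x y => k * f x y)%R = k%:E * dint f.
Proof.
move=> k0 f0 mf; rewrite /dint -ge0_integralZl//.
- apply: eq_integral => x _; rewrite -ge0_integralZl//.
  + exact: measurable_mfun2.
  + by move=> y _; rewrite lee_fin.
- exact: measurable_int_mfun2.
- by move=> x _; apply: integral_ge0 => y _; rewrite lee_fin.
Qed.

Lemma dintD f g : (forall x y, 0 <= f x y)%R -> (forall x y, 0 <= g x y)%R ->
  mfun2 f -> mfun2 g -> dint (fun x y => f x y + g x y)%R = dint f + dint g.
Proof.
move=> f0 g0 mf mg; rewrite /dint -ge0_integralD//.
- apply: eq_integral => x _; rewrite -ge0_integralD//.
  + by move=> y _; rewrite lee_fin.
  + exact: measurable_mfun2.
  + by move=> y _; rewrite lee_fin.
  + exact: measurable_mfun2.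
- by move=> x _; apply: integral_ge0 => y _; rewrite lee_fin.
- exact: measurable_int_mfun2.
- by move=> x _; apply: integral_ge0 => y _; rewrite lee_fin.
- exact: measurable_int_mfun2.
Qed.

Lemma dint_sum (I : eqType) (s : seq I) (f : I -> T -> T -> R) :
  (forall i x y, 0 <= f i x y)%R -> (forall i, mfun2 (f i)) ->
  dint (fun x y => \sum_(i <- s) f i x y)%R = \sum_(i <- s) dint (f i).
Proof.
move=> f0 mf; rewrite /dint -ge0_integral_sum//.
- apply: eq_integral => x _; rewrite -ge0_integral_sum//.
  + by apply: eq_integral => y _; rewrite sumEFin.
  + by move=> i; exact: measurable_mfun2.
  + by move=> i y _; rewrite lee_fin.
- by move=> i; exact: measurable_int_mfun2.
- by move=> i x _; apply: integral_ge0 => y _; rewrite lee_fin.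
Qed.

End double_integral.

(** * Inequalities for real powers *)

Lemma maxr0_lip {R : realType} (a b : R) :
  `|Num.max a 0 - Num.max b 0| <= `|a - b|.
Proof.
have := ler_norm (a - b); have := ler_norm (b - a); rewrite distrC ler_norml.
set N := `|a - b|; rewrite !maxEle => ? ?.
by case: ifPn; case: ifPn; rewrite -?ltNge => *; apply/andP; split; lra.
Qed.

Lemma powR_invr {R : realType} (x a : R) : 0 <= x -> x^-1 `^ a = (x `^ a)^-1.
Proof. by move=> x0; rewrite -[x^-1]powR_inv1// -powRrM mulN1r powRN. Qed.

Lemma powR_divr {R : realType} (x y a : R) : 0 <= x -> 0 <= y ->
  (x / y) `^ a = x `^ a / y `^ a.
Proof. by move=> x0 y0; rewrite powRM ?invr_ge0// powR_invr. Qed.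

Section powR_inequalities.
Context {R : realType}.
Implicit Types a b p : R.

Lemma powRD_le a b p : 1 <= p -> 0 <= a -> 0 <= b ->
  (a + b) `^ p <= 2 `^ (p - 1) * (a `^ p + b `^ p).
Proof.
move=> p1 a0 b0.
have h0 : 0 <= 2^-1 :> R by rewrite invr_ge0.
have h1 : 2^-1 <= 1 :> R by lra.
have H : (2^-1 * (2 * a) + 2^-1 * (2 * b)) `^ p <=
    2^-1 * (2 * a) `^ p + 2^-1 * (2 * b) `^ p.
  have -> : 2^-1 * (2 * b) = (1 - 2^-1) * (2 * b) by lra.
  rewrite [X in _ + X * (2 * b) `^ p](_ : _ = 1 - 2^-1); last by lra.
  by apply: (convex_powR p1 (Itv01 h0 h1)); rewrite inE/= in_itv/= andbT mulr_ge0.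
move: H; rewrite !mulrA mulVf// !mul1r => /le_trans; apply.
rewrite !powRM// -mulrDr -mulrDr mulrA.
rewrite powRB ?pnatr_eq0 ?implybT// powRr1// (mulrC (2^-1)).
exact: lexx.
Qed.

Lemma norm_powRD_le a b p : 1 <= p ->
  `|a + b| `^ p <= 2 `^ (p - 1) * (`|a| `^ p + `|b| `^ p).
Proof.
move=> p1; apply: le_trans (powRD_le p1 (normr_ge0 a) (normr_ge0 b)).
by rewrite ge0_ler_powR ?nnegrE ?ler_normD ?addr_ge0// (le_trans _ p1).
Qed.

Lemma powR_superadditive a b p : 1 <= p -> 0 <= a -> 0 <= b ->
  a `^ p + b `^ p <= (a + b) `^ p.
Proof.
move=> p1 a0 b0; have p0 : 0 <= p by exact: le_trans p1.
have [ab0|ab0] := eqVneq (a + b) 0.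
  have a00 : a = 0 by apply/eqP; rewrite eq_le a0 andbT; lra.
  have b00 : b = 0 by lra.
  by rewrite a00 b00 addr0 powR0 ?addr0 ?gt_eqF// ?(lt_le_trans _ p1).
have ab : 0 < a + b by rewrite lt_neqAle eq_sym ab0 addr_ge0.
have H c : 0 <= c -> c <= a + b -> c `^ p <= c / (a + b) * (a + b) `^ p.
  move=> c0 cab; rewrite -{1}(divfK ab0 c) powRM ?divr_ge0 ?(ltW ab)//.
  rewrite ler_wpM2r ?powR_ge0//; have [->|c00] := eqVneq c 0.
    by rewrite mul0r powR0// gt_eqF// (lt_le_trans _ p1).
  apply: ge1r_powR => //; rewrite ler_pdivrMr// mul1r cab andbT.
  by rewrite divr_gt0// lt_neqAle eq_sym c00.
apply: le_trans (lerD (H a a0 _) (H b b0 _)) _; rewrite ?lerDl ?lerDr//.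
by rewrite -mulrDl -mulrDl divff// mul1r.
Qed.

Lemma sum_powR_le (f : nat -> R) (p : R) (I : nat) : 1 <= p -> (forall i, 0 <= f i) ->
  \sum_(i < I) f i `^ p <= (\sum_(i < I) f i) `^ p.
Proof.
move=> p1 f0; elim: I => [|I IH]; first by rewrite !big_ord0 powR_ge0.
rewrite !big_ord_recr/=; apply: le_trans (powR_superadditive p1 _ _) => //.
  by rewrite lerD2r.
exact: sumr_ge0.
Qed.

(** Convexity of the power at [x] and [y / (1 - theta)], with weights [theta] and
    [1 - theta]. *)
Lemma powR_wconvex (p theta x y : R) : 1 <= p -> 0 < theta < 1 -> 0 <= x -> 0 <= y ->
  (theta * x + y) `^ p <= theta * x `^ p + (1 - theta) `^ (1 - p) * y `^ p.
Proof.
move=> p1 /andP[th0 th1] x0 y0; have d0 : 0 < 1 - theta by rewrite subr_gt0.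
have th1' : theta <= 1 by exact: ltW.
have H : (theta * x + (1 - theta) * (y / (1 - theta))) `^ p <=
    theta * x `^ p + (1 - theta) * (y / (1 - theta)) `^ p.
  by apply: (convex_powR p1 (Itv01 (ltW th0) th1'));
    rewrite inE/= in_itv/= andbT// divr_ge0// ltW.
move: H; rewrite (mulrC (1 - theta)) divfK ?gt_eqF// => /le_trans; apply.
rewrite lerD2l powRM ?invr_ge0 ?(ltW d0)// -powR_inv1 ?(ltW d0)// -powRrM mulN1r.
have -> : (1 - theta) `^ (1 - p) = (1 - theta) * (1 - theta) `^ (- p).
  by rewrite powRD ?(gt_eqF d0) ?implybT// powRr1 ?(ltW d0).
by rewrite le_eqVlt; apply/orP; left; apply/eqP; ring.
Qed.

Lemma one_sub_powR2 (w : R) : 0 <= w -> w * ln 2 / (1 + w * ln 2) <= 1 - 2 `^ (- w).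
Proof.
move=> w0; have l0 : 0 <= w * ln 2 :> R by rewrite mulr_ge0// ln_ge0// ler1n.
rewrite /powR pnatr_eq0/= mulNr expRN.
have := expR_ge1Dx (w * ln 2); set z := w * ln 2 in l0 *; move=> H.
have z1 : 0 < 1 + z by lra.
have : (expR z)^-1 <= (1 + z)^-1 by rewrite lef_pV2 ?posrE ?expR_gt0.
have -> : z / (1 + z) = 1 - (1 + z)^-1 by field; rewrite gt_eqF.
lra.
Qed.

(** Keeps [x `^ e] bounded when [e] is small and [x] is of order [1 / e]. *)
Lemma powR_inv_le (x e : R) : 0 < x -> 0 <= e -> x `^ e <= expR (e * x).
Proof.
move=> x0 e0; rewrite /powR gt_eqF// ler_expR ler_wpM2l//.
exact/ltW/ln_sublinear.
Qed.

End powR_inequalities.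

(** * Nonlocal energies: one scale controls all smaller ones *)

Section kernel_energy.
Context {R : realType} {n : nat}.
Variables (x0 : n.-tuple R) (r p : R).
Hypotheses (r0 : 0 < r) (p1 : 1 <= p).
Implicit Types (k : R -> R) (u : n.-tuple R -> R) (t : R).

Local Notation B := (eball x0 r).

(** The domain of integration is encoded by indicators, so that Fubini's theorem and
    the change of variables apply on the whole space. *)
Definition kform k u (x y : n.-tuple R) : R :=
  \1_B x * \1_B y * (k (edist x y) * `|u x - u y| `^ p).

Definition kenergy k u : \bar R := dint (leb n) (kform k u).

Definition near_ind t : R -> R := fun d => (d < t)%R%:R.

Lemma near_ind_ge0 t d : 0 <= near_ind t d. Proof. exact: ler0n. Qed.

Lemma measurable_near_ind t : measurable_fun setT (near_ind t).
Proof.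
rewrite (_ : near_ind t = \1_(`]-oo, t[%classic)).
  by apply: measurable_indic; exact: measurable_itv.
by apply/funext => d; rewrite /near_ind indicE mem_setE in_itv/=.
Qed.

Lemma kform_ge0 k u x y : (forall d, 0 <= k d) -> 0 <= kform k u x y.
Proof. by move=> k0; rewrite /kform !mulr_ge0 ?powR_ge0. Qed.

Lemma mfun2_kform k u : measurable_fun setT k -> measurable_fun setT u ->
  mfun2 (kform k u).
Proof.
move=> mk mu; have mB := measurable_eball x0 r.
have mf : measurable_fun setT (fst : n.-tuple R * n.-tuple R -> _) by exact: measurable_fst.
have ms : measurable_fun setT (snd : n.-tuple R * n.-tuple R -> _) by exact: measurable_snd.
apply: measurable_funM; apply: measurable_funM.
- by apply: (measurableT_comp _ mf); exact: measurable_indic.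
- by apply: (measurableT_comp _ ms); exact: measurable_indic.
- by apply: (measurableT_comp mk); exact: measurable_edist.
- apply: (measurableT_comp (measurable_powR _)); apply: measurableT_comp => //.
  by apply: measurable_funB; [exact: (measurableT_comp mu mf)|
                              exact: (measurableT_comp mu ms)].
Qed.

(** The two differences through the midpoint are at half the distance, and the
    midpoint is still in the ball. *)
Lemma kform_double t u x y :
  kform (near_ind t) u x y <= 2 `^ (p - 1) *
    (kform (near_ind (t / 2)) u x (seg 2^-1 x y) +
     kform (near_ind (t / 2)) u y (seg 2^-1 y x)).
Proof.
have h0 : 0 <= 2^-1 :> R by rewrite invr_ge0.
have [xB|xB] := boolP (x \in B); last first.
  rewrite {1}/kform indicE (negbTE xB) !mul0r mulr_ge0 ?powR_ge0//.
  by rewrite addr_ge0// kform_ge0// => d; exact: near_ind_ge0.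
have [yB|yB] := boolP (y \in B); last first.
  rewrite {1}/kform [\1_B y]indicE (negbTE yB) mulr0 !mul0r mulr_ge0 ?powR_ge0//.
  by rewrite addr_ge0// kform_ge0// => d; exact: near_ind_ge0.
have wB : seg 2^-1 x y \in B.
  by move: xB yB; rewrite !inE => xB yB; apply: eball_convex => //; lra.
rewrite /kform -(seg_half x y) !indicE xB yB wB !mul1r.
rewrite edist_seg// {2}(seg_half x y) edist_seg// (edistC y x).
have -> : near_ind (t / 2) (2^-1 * edist x y) = near_ind t (edist x y).
  by rewrite /near_ind mulrC ltr_pM2r// invr_gt0.
rewrite -mulrDr mulrCA ler_wpM2l ?near_ind_ge0//.
have := norm_powRD_le (u x - u (seg 2^-1 x y)) (u (seg 2^-1 x y) - u y) p1.
by rewrite addrA subrK (distrC (u (seg _ _ _)) (u y)).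
Qed.

(** The two terms produced by the midpoint have the same integral, by symmetry;
    substituting the midpoint for [y] then costs a factor [2 ^+ n]. It is essential
    that the constant is exactly [2 ^+ n * 2 `^ p], since the estimate is iterated
    over arbitrarily many scales. *)
Lemma kenergy_double t u : measurable_fun setT u ->
  (kenergy (near_ind t) u <= (2 ^+ n * 2 `^ p)%:E * kenergy (near_ind (t / 2)) u)%E.
Proof.
move=> mu; set K := kform (near_ind (t / 2)) u.
have K0 x y : 0 <= K x y by apply: kform_ge0 => d; exact: near_ind_ge0.
have mK : mfun2 K by apply: mfun2_kform => //; exact: measurable_near_ind.
have h0 : 0 < 2^-1 :> R by rewrite invr_gt0.
pose F x y := K x (seg 2^-1 x y).
have F0 x y : 0 <= F x y by exact: K0.
have mF : mfun2 F.
  have mf : measurable_fun setT (fst : n.-tuple R * n.-tuple R -> _) by exact: measurable_fst.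
  have ms : measurable_fun setT (snd : n.-tuple R * n.-tuple R -> _) by exact: measurable_snd.
  apply: (measurableT_comp mK (_ : measurable_fun setT
    (fun z : n.-tuple R * n.-tuple R => (z.1, seg 2^-1 z.1 z.2)))).
  apply/measurable_fun_pair => //; apply/measurable_fun_tnthP => i.
  rewrite (_ : _ \o _ = fun z : n.-tuple R * n.-tuple R =>
    (1 - 2^-1) * tnth z.1 i + 2^-1 * tnth z.2 i); last first.
    by apply/funext => z /=; rewrite tnth_seg.
  by apply: measurable_funD; apply: measurable_funM => //;
    [exact: (measurableT_comp (@measurable_tnth _ _ _ i) mf)|
     exact: (measurableT_comp (@measurable_tnth _ _ _ i) ms)].
have dF : dint (leb n) F = ((2 ^+ n)%:E * dint (leb n) K)%E.
  rewrite /dint -ge0_integralZl//.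
  - apply: eq_integral => x _; rewrite -(invrK 2).
    rewrite -(ge0_integral_aff [tuple (1 - 2^-1) * tnth x i | i < n] h0)//.
    + exact: measurable_mfun2.
    + by move=> y; rewrite lee_fin.
  - exact: measurable_int_mfun2.
  - by move=> x _; apply: integral_ge0 => y _; rewrite lee_fin.
apply: (@le_trans _ _ (dint (leb n) (fun x y => 2 `^ (p - 1) * (F x y + F y x)))).
  apply: le_dint => x y; last exact: kform_double.
  by apply: kform_ge0 => d; exact: near_ind_ge0.
have mF' : mfun2 (fun x y => F y x).
  exact: (mfun2_swap mF).
rewrite dintZ ?powR_ge0//; last 2 first.
- by move=> x y; rewrite addr_ge0.
- exact: measurable_funD.
rewrite dintD// -(dintC (leb n) F0 mF) dF.
set Z := ((_ * dint _ K))%E.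
rewrite [X in (_ * X <= _)%E](_ : _ = 2%:E * Z)%E; last first.
  have -> : (2%:E = 1 + 1 :> \bar R)%E by rewrite -EFinD.
  by rewrite ge0_muleDl// mul1e.
rewrite {}/Z.
rewrite !muleA -!EFinM /kenergy lee_wpmul2r ?dint_ge0// lee_fin.
rewrite [leLHS](_ : _ = 2 ^+ n * (2 `^ (p - 1) * 2)); last by ring.
rewrite powRB ?pnatr_eq0 ?implybT// powRr1// divfK//.
Qed.

Lemma kenergy_doubleX t u m : measurable_fun setT u ->
  (kenergy (near_ind t) u <=
   ((2 ^+ n * 2 `^ p) ^+ m)%:E * kenergy (near_ind (t / 2 ^+ m)) u)%E.
Proof.
move=> mu; elim: m => [|m IH]; first by rewrite !expr0 mul1e divr1.
apply: le_trans IH _; rewrite exprSr EFinM -muleA; apply: lee_wpmul2l.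
  by rewrite lee_fin exprn_ge0// mulr_ge0 ?powR_ge0// exprn_ge0.
apply: le_trans (kenergy_double _ mu) _.
by rewrite -mulrA -invfM -exprSr.
Qed.

End kernel_energy.

(** * Truncations and energies between levels *)

Section level_lower_bound.
Context {R : realType} {n : nat}.
Variables (x0 : n.-tuple R) (r p : R).
Hypothesis r0 : 0 < r.

Local Notation B := (eball x0 r).
Local Notation V := (vol (eball x0 r)).

Lemma leb_ball : leb n B = V%:E.
Proof. by rewrite /vol fineK// ge0_fin_numE// leb_eball_lty. Qed.

(** For [x] in [G] consider the copy of the ball shrunk towards [x] by the factor
    [2 ^+ i]. It lies in the ball, all its points are closer to [x] than
    [2 * r / 2 ^+ i], and its measure is [2 * b]; so [u] vanishes on a part of it of
    measure at least [b], where the integrand is [h `^ p]. *)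
Lemma level_lower_bound (i : nat) (u : n.-tuple R -> R) (h b b' : R)
    (G : set (n.-tuple R)) :
  measurable_fun setT u -> 0 <= h -> measurable G -> G `<=` B ->
  (forall x, G x -> u x = h) ->
  V = 2 * b * (2 ^+ n) ^+ i ->
  (leb n (B `&` [set y | (u y != 0)%R]) <= b%:E)%E -> (b'%:E <= leb n G)%E ->
  ((h `^ p * b * b')%:E <= kenergy x0 r p (near_ind (2 * r / 2 ^+ i)) u)%E.
Proof.
move=> mu h0 mG GB uG Vb ub Gb'.
have mB := measurable_eball x0 r.
have q0 : 0 < 2 ^+ i :> R by rewrite exprn_gt0.
pose N := B `&` [set y | u y != 0].
have mN : measurable N.
  apply: measurableI => //; rewrite (_ : [set y | _] = ~` (u @^-1` [set 0])).
    by apply: measurableC; rewrite -[X in measurable X]setTI; exact: mu.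
  by apply/seteqP; split => y /= /eqP.
have b0 : 0 <= b.
  by rewrite -lee_fin; apply: le_trans ub; exact: measure_ge0.
(* The shrunken copy of the ball, as a preimage under the inverse dilation. *)
pose D x := seg (2 ^+ i) x @^-1` B.
have mD x : measurable (D x).
  by rewrite -[D x]setTI; exact: measurable_aff.
have lD x : leb n (D x) = (2 * b)%:E.
  rewrite /D leb_aff// leb_ball -EFinM Vb; congr EFin.
  rewrite exprVn -[(2 ^+ i) ^+ n]exprM -[(2 ^+ n) ^+ i]exprM (mulnC n i).
  by rewrite mulrC mulfK// expf_neq0.
have DB x y : G x -> D x y -> B y /\ edist x y < 2 * r / 2 ^+ i.
  move=> /GB Bx Dy; have yE : y = seg (2 ^+ i)^-1 x (seg (2 ^+ i) x y).
    by rewrite segK// gt_eqF.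
  split.
    rewrite yE; apply: eball_convex => //; rewrite invr_ge0 (ltW q0)/=.
    by rewrite invf_le1// exprn_ege1// ler1n.
  rewrite yE edist_seg ?invr_ge0 ?(ltW q0)// mulrC ltr_pM2r ?invr_gt0//.
  exact: eball_edist Dy.
have bA x : G x -> (b%:E <= leb n (D x `\` N))%E.
  move=> Gx; have : (leb n (D x) <= leb n (D x `\` N) + leb n N)%E.
    apply: le_trans (measureU2 _ _ _) => //; last exact: measurableD.
    apply: le_measure; rewrite ?inE//; first by apply: measurableU => //; exact: measurableD.
    by move=> y Dy; have [Ny|Ny] := pselect (N y); [right|left].
  rewrite lD => H; have {}H : ((2 * b)%:E <= leb n (D x `\` N) + b%:E)%E.
    by apply: le_trans H _; rewrite leeD2l.
  by rewrite -leeBlDr// in H; move: H; rewrite -EFinB mulr2n mulrDl !mul1r addrK.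
have hp0 : 0 <= h `^ p by exact: powR_ge0.
have K0 x y : 0 <= kform x0 r p (near_ind (2 * r / 2 ^+ i)) u x y.
  by apply: kform_ge0 => d; exact: near_ind_ge0.
apply: (@le_trans _ _ (\int[leb n]_x ((h `^ p * b)%:E * (\1_G x)%:E))%E).
  rewrite ge0_integralZl//; last by rewrite lee_fin mulr_ge0.
    rewrite integral_indic// setIT EFinM; apply: lee_wpmul2l => //.
    by rewrite lee_fin mulr_ge0.
  exact/measurable_EFinP/measurable_indic.
rewrite /kenergy /dint; apply: le_integral_nomeas => x _.
  by rewrite mule_ge0// lee_fin// mulr_ge0.
have [Gx|Gx] := pselect (G x); last first.
  rewrite indicE memNset// mule0; apply: integral_ge0 => y _; by rewrite lee_fin.
rewrite indicE mem_set// mule1.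
apply: (@le_trans _ _ (\int[leb n]_y ((h `^ p)%:E * (\1_(D x `\` N) y)%:E))%E).
  rewrite ge0_integralZl//; last exact/measurable_EFinP/measurable_indic/measurableD.
  rewrite integral_indic//; last exact: measurableD.
  by rewrite setIT EFinM; apply: lee_wpmul2l => //; exact: bA.
apply: le_integral_nomeas => y _; first by rewrite mule_ge0// lee_fin.
have [DN|DN] := pselect ((D x `\` N) y); last first.
  by rewrite indicE memNset// mule0 lee_fin.
rewrite indicE mem_set// mule1 lee_fin /kform.
have [Dy /= Ny] := DN; have [By dxy] := DB _ _ Gx Dy.
have uy : u y = 0 by apply/eqP/negPn/negP => uy; apply: Ny.
by rewrite !indicE !mem_set//; [rewrite /near_ind dxy !mul1r uG// uy subr0 ger0_norm|exact: GB].
Qed.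

End level_lower_bound.

Section truncation.
Context {R : realType}.
Implicit Types a b s : R.

Definition trunc a b s : R := Num.min (Num.max (s - a) 0) (b - a).

Lemma trunc_ge a b s : a <= b -> b <= s -> trunc a b s = b - a.
Proof. by move=> ab bs; rewrite /trunc max_l ?min_r ?lerD2r// subr_ge0 (le_trans ab). Qed.

Lemma trunc_le a b s : a <= b -> s <= a -> trunc a b s = 0.
Proof. by move=> ab sa; rewrite /trunc max_r ?min_l ?subr_ge0// subr_le0. Qed.

Lemma trunc_mid a b s : a <= s <= b -> trunc a b s = s - a.
Proof. by move=> /andP[? ?]; rewrite /trunc max_l ?min_l ?lerD2r// subr_ge0. Qed.

Lemma truncD a b c s : a <= b -> b <= c -> trunc a b s + trunc b c s = trunc a c s.
Proof.
move=> ab bc; have ac := le_trans ab bc.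
have [sa|/ltW sa] := leP s a.
  by rewrite !trunc_le ?addr0// (le_trans sa).
have [sb|/ltW sb] := leP s b.
  by rewrite trunc_mid ?sa// trunc_le// trunc_mid ?sa ?(le_trans sb)// addr0.
have [sc|/ltW sc] := leP s c.
  rewrite trunc_ge// trunc_mid ?sb// trunc_mid ?sa//; ring.
by rewrite !trunc_ge//; ring.
Qed.

Lemma trunc_lip a b s s' : a <= b -> s' <= s ->
  0 <= trunc a b s - trunc a b s' <= s - s'.
Proof.
move=> ab ss; rewrite /trunc.
rewrite !minEle !maxEle.
by repeat case: ifPn; rewrite -?ltNge => *; apply/andP; split; lra.
Qed.

Lemma sum_trunc (t : nat -> R) (I : nat) s : (forall i, t i <= t i.+1) ->
  \sum_(i < I) trunc (t i) (t i.+1) s = trunc (t 0) (t I) s.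
Proof.
move=> ndt; elim: I => [|I IH]; first by rewrite big_ord0 /trunc subrr min_r// le_max lexx orbT.
rewrite big_ord_recr/= IH truncD//.
by elim: I {IH} => // I IH; exact: le_trans IH _.
Qed.

(** The increments of the truncations of [s] and [s'] all have the same sign, they
    add up to the increment of one truncation, which is a contraction, and powers
    with exponent at least 1 are superadditive. *)
Lemma sum_trunc_powR (t : nat -> R) (I : nat) (p s s' : R) : 1 <= p ->
  (forall i, t i <= t i.+1) ->
  \sum_(i < I) `|trunc (t i) (t i.+1) s - trunc (t i) (t i.+1) s'| `^ p
    <= `|s - s'| `^ p.
Proof.
move=> p1 ndt; wlog ss : s s' / s' <= s => [H|].
  have [|/ltW ss] := leP s' s; first exact: H.
  rewrite distrC; apply: le_trans (H _ _ ss).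
  by apply: ler_sum => i _; rewrite distrC.
have tI : t 0 <= t I by elim: I => // I IH; exact: le_trans IH _.
pose f i := trunc (t i) (t i.+1) s - trunc (t i) (t i.+1) s'.
have f0 i : 0 <= f i by have /andP[] := trunc_lip (ndt i) ss.
rewrite (eq_bigr (fun i : 'I_I => f i `^ p)); last first.
  by move=> i _; rewrite ger0_norm//; exact: f0.
apply: le_trans (sum_powR_le _ p1 f0) _.
rewrite ge0_ler_powR ?nnegrE ?sumr_ge0 ?(le_trans _ p1)//.
rewrite sumrB !sum_trunc// ger0_norm ?subr_ge0//.
by have /andP[] := trunc_lip tI ss.
Qed.

Lemma measurable_trunc d (T : measurableType d) a b (f : T -> R) :
  measurable_fun setT f -> measurable_fun setT (fun x => trunc a b (f x)).
Proof.
move=> mf; apply: measurable_minr => //; apply: measurable_maxr => //.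
exact: measurable_funB.
Qed.

End truncation.

Section multiscale.
Context {R : realType} {n : nat}.
Variables (x0 : n.-tuple R) (r p : R).
Hypotheses (r0 : 0 < r) (p1 : 1 <= p).

Local Notation B := (eball x0 r).
Local Notation V := (vol (eball x0 r)).
Local Notation D := (2 ^+ n * 2 `^ p : R).
Local Notation tau k := (2 * r / 2 ^+ k).

(** When [f k] is the value of [phi] at [2 * r / 2 ^+ k], this is a Borel function
    below a multiple of the kernel [phi d / d ^ (n + p)] of the energy. *)
Definition multiscale (f : nat -> R) (N : nat) : R -> R :=
  fun d => \sum_(k < N) f k * D ^+ k * near_ind (tau k) d.

Variable f : nat -> R.
Hypothesis f0 : forall k, 0 <= f k.

Let D0 : 0 < D. Proof. by rewrite mulr_gt0 ?powR_gt0 ?exprn_gt0. Qed.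

Let fD0 k : 0 <= f k * D ^+ k.
Proof. by rewrite mulr_ge0// exprn_ge0// ltW. Qed.

Lemma multiscale_ge0 N d : 0 <= multiscale f N d.
Proof. by apply: sumr_ge0 => k _; rewrite mulr_ge0// near_ind_ge0. Qed.

Lemma measurable_multiscale N : measurable_fun setT (multiscale f N).
Proof.
apply: measurable_sum => k; apply: measurable_funM => //.
exact: measurable_near_ind.
Qed.

Lemma kenergy_multiscale N u : measurable_fun setT u ->
  kenergy x0 r p (multiscale f N) u =
  (\sum_(k < N) (f k * D ^+ k)%:E * kenergy x0 r p (near_ind (tau k)) u)%E.
Proof.
move=> mu.
have K0 k x y : 0 <= kform x0 r p (near_ind (tau k)) u x y.
  by apply: kform_ge0 => d; exact: near_ind_ge0.
have mK k : mfun2 (kform x0 r p (near_ind (tau k)) u).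
  by apply: mfun2_kform => //; exact: measurable_near_ind.
rewrite /kenergy (_ : kform x0 r p (multiscale f N) u = fun x y =>
  \sum_(k < N) f k * D ^+ k * kform x0 r p (near_ind (tau k)) u x y).
  rewrite dint_sum; last 2 first.
  - by move=> k x y; rewrite mulr_ge0.
  - by move=> k; apply: measurable_funM => //; exact: mK.
  by apply: eq_bigr => k _; rewrite dintZ.
apply/funext => x; apply/funext => y; rewrite /kform /multiscale mulr_suml mulr_sumr.
by apply: eq_bigr => k _; ring.
Qed.

(** By [kenergy_doubleX] the term of a scale [k >= i] is at least [f k * D ^+ i] times
    the energy at scale [i]: the weights [D ^+ k] compensate the doubling constant. *)
Lemma kenergy_multiscale_ge N i u : measurable_fun setT u -> (i <= N)%N ->
  ((D ^+ i * \sum_(i <= k < N) f k)%:E * kenergy x0 r p (near_ind (tau i)) u <=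
   kenergy x0 r p (multiscale f N) u)%E.
Proof.
move=> mu iN; rewrite kenergy_multiscale//.
have J0 k : (0 <= kenergy x0 r p (near_ind (tau k)) u)%E.
  by apply: dint_ge0 => x y; apply: kform_ge0 => d; exact: near_ind_ge0.
rewrite -(big_mkord xpredT (fun k => (f k * D ^+ k)%:E *
   kenergy x0 r p (near_ind (tau k)) u)%E) [leRHS](big_cat_nat (n := i))//=.
apply: (@le_trans _ _ (\sum_(i <= k < N)
   (f k * D ^+ k)%:E * kenergy x0 r p (near_ind (tau k)) u)%E); last first.
  by rewrite leeDr//; apply: sume_ge0 => k _; rewrite mule_ge0// lee_fin.
rewrite mulr_sumr -sumEFin ge0_sume_distrl; last first.
  by move=> k _; rewrite lee_fin mulr_ge0// exprn_ge0// ltW.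
rewrite big_nat_cond [leRHS]big_nat_cond; apply: lee_sum => k /andP[/andP[ik kN] _].
have := kenergy_doubleX x0 r0 p1 (tau i) (k - i) mu.
have -> : 2 * r / 2 ^+ i / 2 ^+ (k - i) = 2 * r / 2 ^+ k.
  by rewrite -[LHS]mulrA -invfM -exprD subnKC.
move=> H.
apply: le_trans (lee_wpmul2l _ H) _; first by rewrite lee_fin mulr_ge0// exprn_ge0// ltW.
rewrite muleA -EFinM lee_wpmul2r// lee_fin (mulrC _ (f k)) -mulrA -exprD subnKC//.
Qed.

Lemma kenergy_trunc_sum (k : R -> R) (t : nat -> R) I u :
  (forall d, 0 <= k d) -> measurable_fun setT k -> measurable_fun setT u ->
  (forall i, t i <= t i.+1) ->
  (\sum_(i < I) kenergy x0 r p k (fun x => trunc (t i) (t i.+1) (u x)) <=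
   kenergy x0 r p k u)%E.
Proof.
move=> k0 mk mu ndt; rewrite /kenergy -dint_sum; last 2 first.
- by move=> i x y; exact: kform_ge0.
- by move=> i; apply: mfun2_kform => //; exact: measurable_trunc.
apply: le_dint => x y; first by apply: sumr_ge0 => i _; exact: kform_ge0.
rewrite /kform -mulr_sumr -mulr_sumr; apply: ler_wpM2l; first by rewrite mulr_ge0.
by apply: ler_wpM2l => //; exact: sum_trunc_powR.
Qed.

(** Each truncation is tested at its own scale with [level_lower_bound], and the
    energies of the truncations are added. The hypothesis on [f] compares the sum of
    [f] from [i] on with its sum from 0 on. *)
Lemma level_energy (c rho : R) (u : n.-tuple R -> R) (t : nat -> R) (I M : nat) :
  0 <= c -> 0 <= rho ->
  (forall i k, c * rho ^+ i * f k <= f (i + k)%N) ->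
  measurable_fun setT u ->
  (forall i, t i <= t i.+1) ->
  (forall i, (leb n (B `&` [set x | (t i < u x)%R]) <=
     (V / 2 / (2 ^+ n) ^+ i)%:E)%E) ->
  (forall i, ((V / 2 / (2 ^+ n) ^+ i.+1)%:E <=
     leb n (B `&` [set x | (t i.+1 <= u x)%R]))%E) ->
  ((\sum_(i < I) (t i.+1 - t i) `^ p * (2 `^ p * rho / 2 ^+ n) ^+ i *
     ((V / 2) ^+ 2 / 2 ^+ n * c * \sum_(k < M) f k))%:E <=
   kenergy x0 r p (multiscale f (I + M)) u)%E.
Proof.
move=> c0 rho0 frho mu ndt tub tlb.
apply: le_trans (kenergy_trunc_sum I (multiscale_ge0 _) (measurable_multiscale _) mu ndt).
rewrite -sumEFin; apply: lee_sum => i _.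
set T := fun x => trunc (t i) (t i.+1) (u x).
have mT : measurable_fun setT T by exact: measurable_trunc.
have mB := measurable_eball x0 r.
have iIM : (i <= I + M)%N by rewrite (leq_trans (ltnW (ltn_ord i)))// leq_addr.
apply: le_trans (kenergy_multiscale_ge mT iIM).
have q0 : 0 < (2 ^+ n : R) by rewrite exprn_gt0.
have V0 : 0 <= V by rewrite /vol fine_ge0.
have Ju : (((t i.+1 - t i) `^ p * (V / 2 / (2 ^+ n) ^+ i) * (V / 2 / (2 ^+ n) ^+ i.+1))%:E
    <= kenergy x0 r p (near_ind (tau i)) T)%E.
  apply: (@level_lower_bound _ _ _ _ _ r0 _ _ _ _ _
     (B `&` [set x | (t i.+1 <= u x)%R])) => //.
  - by rewrite subr_ge0.
  - apply: measurableI => //; rewrite -[X in measurable X]setTI.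
    by apply: measurable_fun_le.
  - by move=> x [_ /= tu]; rewrite /T trunc_ge.
  - by field; rewrite expf_neq0// gt_eqF.
  - apply: le_trans (tub i); apply: le_measure; rewrite ?inE.
    + apply: measurableI => //; rewrite (_ : [set y | _] = ~` (T @^-1` [set 0])).
        by apply: measurableC; rewrite -[X in measurable X]setTI; exact: mT.
      by apply/seteqP; split => y /= /eqP.
    + apply: measurableI => //; rewrite -[X in measurable X]setTI.
      under eq_set do rewrite -lte_fin.
      by apply: measurable_lte => //; apply/measurable_EFinP.
    + move=> y [By /= Ty]; split => //=; rewrite ltNge; apply: contra Ty => ut.
      by rewrite /T trunc_le.
apply: le_trans (lee_wpmul2l _ Ju); last first.
  by rewrite lee_fin mulr_ge0 ?sumr_ge0// exprn_ge0// ltW.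
have Sf : c * rho ^+ i * \sum_(k < M) f k <= \sum_(i <= k < I + M) f k.
  rewrite mulr_sumr (@le_trans _ _ (\sum_(i <= k < i + M) f k))//.
    rewrite -{2}(add0n (i : nat)) big_addn addKn big_mkord; apply: ler_sum => k _.
    by rewrite addnC.
  rewrite [leRHS](big_cat_nat (n := i + M))/= ?leq_addr ?leq_add2r ?(ltnW (ltn_ord i))//.
  by rewrite lerDl sumr_ge0.
rewrite -EFinM lee_fin.
apply: le_trans (ler_wpM2r _ (ler_wpM2l _ Sf)); last 2 first.
- by rewrite !mulr_ge0 ?powR_ge0// ?divr_ge0 ?exprn_ge0 ?(ltW q0).
- by rewrite exprn_ge0// ltW.
rewrite le_eqVlt; apply/orP; left; apply/eqP.
rewrite !exprMn exprVn !exprS; field.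
by rewrite expf_neq0// gt_eqF.
Qed.

End multiscale.

(** * Quantiles *)

Section quantile.
Context d (T : measurableType d) (R : realType).
Variable mu : {measure set T -> \bar R}.
Variables (B : set T) (u : T -> R).
Hypotheses (mB : measurable B) (Boo : (mu B < +oo)%E) (mf : measurable_fun setT u).
Local Open Scope ereal_scope.

Definition over t := B `&` [set x | (t < u x)%R].

Definition quantile (b : R) : R := inf [set t | mu (over t) <= b%:E].

Lemma measurable_over t : measurable (over t).
Proof.
apply: measurableI => //; rewrite -[X in measurable X]setTI.
under eq_set do rewrite -lte_fin.
by apply: measurable_lte => //; apply/measurable_EFinP.
Qed.

Lemma le_over s t : (s <= t)%R -> mu (over t) <= mu (over s).
Proof.
move=> st; apply: le_measure; rewrite ?inE; [exact: measurable_over..|].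
by move=> x [Bx /= tu]; split => //=; exact: le_lt_trans tu.
Qed.

Lemma over_lty t : mu (over t) < +oo.
Proof.
apply: le_lt_trans Boo; apply: le_measure; rewrite ?inE//; first exact: measurable_over.
by move=> x [].
Qed.

Let S b := [set t | mu (over t) <= b%:E].

Lemma quantile_set_neq0 b : (0 < b)%R -> S b !=set0.
Proof.
move=> b0; have H : (mu \o (fun k : nat => over k%:R)) @ \oo --> mu (\bigcap_k over k%:R).
  apply: nonincreasing_cvg_mu.
  - exact: over_lty.
  - by move=> k; exact: measurable_over.
  - by apply: bigcapT_measurable => k; exact: measurable_over.
  - move=> i j ij; apply/subsetPset => x [Bx /= tu]; split => //=.
    by apply: le_lt_trans tu; rewrite ler_nat.
have E : \bigcap_k over k%:R = set0.
  apply/seteqP; split => // x /(_ (Num.bound (u x)) Logic.I)[_ /=].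
  by rewrite ltNge => /negP; apply; rewrite ltW// unstable.ltr_bound.
rewrite E measure0 in H.
have /H[k _ /(_ k (leqnn k)) /= kb] : nbhs (0 : \bar R) [set x | x < b%:E].
  by apply: (open_nbhs_nbhs _); split; [exact: open_ereal_lt_ereal|rewrite /= lte_fin].
by exists k%:R; exact: ltW.
Qed.

Lemma quantile_set_lb b : b%:E < mu B -> has_lbound (S b).
Proof.
move=> bB; have H : (mu \o (fun k : nat => over (- k%:R)%R)) @ \oo -->
    mu (\bigcup_k over (- k%:R)%R).
  apply: nondecreasing_cvg_mu.
  - by move=> k; exact: measurable_over.
  - by apply: bigcupT_measurable => k; exact: measurable_over.
  - move=> i j ij; apply/subsetPset => x [Bx /= tu]; split => //=.
    by apply: le_lt_trans tu; rewrite lerN2 ler_nat.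
have E : \bigcup_k over (- k%:R)%R = B.
  apply/seteqP; split => [x [k _ []]//|x Bx]; exists (Num.bound (- u x)) => //.
  by split => //=; rewrite ltrNl unstable.ltr_bound.
rewrite E in H.
have /H[k _ /(_ k (leqnn k)) /= kb] : nbhs (mu B) [set x | b%:E < x].
  by apply: (open_nbhs_nbhs _); split => //; exact: open_ereal_gt_ereal.
exists (- k%:R)%R => t /= tb; rewrite leNgt; apply/negP => tk.
have := lt_le_trans kb (le_over (ltW tk)).
by rewrite ltNge tb.
Qed.

(** Continuity of the measure along the levels decreasing to the quantile. *)
Lemma over_quantile b : (0 < b)%R -> b%:E < mu B ->
  mu (over (quantile b)) <= b%:E.
Proof.
move=> b0 bB; set t := quantile b.
have H : (mu \o (fun k : nat => over (t + k.+1%:R^-1)%R)) @ \oo -->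
    mu (\bigcup_k over (t + k.+1%:R^-1)%R).
  apply: nondecreasing_cvg_mu.
  - by move=> k; exact: measurable_over.
  - by apply: bigcupT_measurable => k; exact: measurable_over.
  - move=> i j ij; apply/subsetPset => x [Bx /= tu]; split => //=.
    by apply: le_lt_trans tu; rewrite lerD2l lef_pV2 ?posrE// ler_nat.
have E : \bigcup_k over (t + k.+1%:R^-1)%R = over t.
  apply/seteqP; split => [x [k _ [Bx /= tu]]|x [Bx /= tu]].
    by split => //=; apply: lt_trans tu; rewrite ltrDl invr_gt0.
  have ut : (0 < u x - t)%R by rewrite subr_gt0.
  exists (Num.truncn (u x - t)^-1) => //; split => //=.
  rewrite -ltrBrDl invf_plt ?posrE// truncnS_gt//.
rewrite E in H; rewrite -(cvg_lim _ H)//; apply: lime_le.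
  by apply/cvg_ex; eexists; exact: H.
apply: nearW => k /=.
have [s Ss st] : exists2 s, S b s & (s < t + k.+1%:R^-1)%R.
  apply: inf_adherent; first by rewrite invr_gt0.
  by split; [exact: quantile_set_neq0|exact: quantile_set_lb].
by apply: le_trans Ss; exact/le_over/ltW.
Qed.

(** Continuity of the measure along the levels increasing to the quantile. *)
Lemma under_quantile b : (0 < b)%R -> b%:E < mu B ->
  b%:E <= mu (B `&` [set x | (quantile b <= u x)%R]).
Proof.
move=> b0 bB; set t := quantile b.
have H : (mu \o (fun k : nat => over (t - k.+1%:R^-1)%R)) @ \oo -->
    mu (\bigcap_k over (t - k.+1%:R^-1)%R).
  apply: nonincreasing_cvg_mu.
  - exact: over_lty.
  - by move=> k; exact: measurable_over.
  - by apply: bigcapT_measurable => k; exact: measurable_over.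
  - move=> i j ij; apply/subsetPset => x [Bx /= tu]; split => //=.
    by apply: le_lt_trans tu; rewrite lerD2l lerN2 lef_pV2 ?posrE// ler_nat.
have E : \bigcap_k over (t - k.+1%:R^-1)%R = B `&` [set x | (t <= u x)%R].
  apply/seteqP; split => [x xk|x [Bx /= tu] k _]; last first.
    by split => //=; apply: lt_le_trans tu; rewrite gtrBl invr_gt0.
  split; first by have [] := xk 0%N Logic.I.
  rewrite /= leNgt; apply/negP => ut.
  have tu : (0 < t - u x)%R by rewrite subr_gt0.
  have [_ /=] := xk (Num.truncn (t - u x)^-1) Logic.I.
  by rewrite ltrBlDl -ltrBlDr ltNge invf_ple ?posrE// ltW// truncnS_gt.
rewrite E in H; rewrite -(cvg_lim _ H)//; apply: lime_ge.
  by apply/cvg_ex; eexists; exact: H.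
apply: nearW => k /=; rewrite leNgt; apply/negP => kb.
have : (t <= t - k.+1%:R^-1)%R.
  by apply: ge_inf; [exact: quantile_set_lb|exact: ltW].
by rewrite leNgt gtrBl invr_gt0 ltr0n.
Qed.

Lemma le_quantile b b' : (0 < b)%R -> (b <= b')%R -> b'%:E < mu B ->
  (quantile b' <= quantile b)%R.
Proof.
move=> b0 bb bB; apply: lb_le_inf; first exact: quantile_set_neq0.
move=> t /= tb; apply: ge_inf; first exact: quantile_set_lb.
by rewrite /=; apply: le_trans tb _; rewrite lee_fin.
Qed.

Lemma quantile_ge0 b : (0 < b)%R -> b%:E < mu B -> (forall x, 0 <= u x)%R ->
  (0 <= quantile b)%R.
Proof.
move=> b0 bB u0; apply: lb_le_inf; first exact: quantile_set_neq0.
move=> t /= tb; rewrite leNgt; apply/negP => t0.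
have E : over t = B.
  by apply/seteqP; split => [x []//|x Bx]; split => //=; exact: lt_le_trans (u0 x).
by rewrite E leNgt bB in tb.
Qed.

(** Where [u] is positive and does not exceed all levels, it lies between two
    consecutive ones, so [u x `^ q] is at most one term of the series of
    [t i.+1 `^ q] times the indicator of [u > t i]. *)
Lemma integral_powR_levels (q : R) (t b : nat -> R) (K : R) :
  (0 < q)%R -> (forall x, 0 <= u x)%R -> t 0%N = 0%R ->
  (forall i, mu (over (t i)) <= (b i)%:E) -> b @ \oo --> (0 : R)%R ->
  (forall I, \sum_(i < I) t i.+1 `^ q * b i <= K)%R ->
  \int[mu]_(x in B) (u x `^ q)%:E <= K%:E.
Proof.
move=> q0 u0 t0 tb b_0 tK.
pose N := \bigcap_i over (t i).
have mN : measurable N by apply: bigcapT_measurable => k; exact: measurable_over.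
have N0 : mu N = 0.
  apply/eqP; rewrite eq_le measure_ge0 andbT; apply/lee_addgt0Pr => e e0.
  rewrite add0e; have /b_0[k _ /(_ k (leqnn k)) /= kb] : nbhs (0%R : R) [set x | (x < e)%R].
    exact: lt_nbhsl.
  apply: (@le_trans _ _ (mu (over (t k)))).
    by apply: le_measure; rewrite ?inE//; [exact: measurable_over|move=> x /(_ k); exact].
  by apply: le_trans (tb k) _; rewrite lee_fin ltW.
pose g i x := (t i.+1 `^ q * \1_(over (t i)) x)%:E.
have g0 i x : 0 <= g i x by rewrite lee_fin mulr_ge0 ?powR_ge0.
have mg i : measurable_fun setT (g i).
  apply/measurable_EFinP; apply: measurable_funM => //.
  exact/measurable_indic/measurable_over.
rewrite (@eq_integral_off_null _ _ _ mu B N _ (patch (fun=> 0) (~` N) (fun x => (u x `^ q)%:E)))//;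
  last by move=> x Bx Nx; rewrite patchE mem_set.
apply: (@le_trans _ _ (\int[mu]_(x in B) \sum_(i <oo) g i x)).
  apply: le_integral_nomeas => x Bx.
    by rewrite patchE; case: ifPn => // _; rewrite lee_fin powR_ge0.
  rewrite patchE; case: ifPn => [/set_mem Nx|_]; last exact: nneseries_ge0.
  have [ux|ux] := eqVneq (u x) 0%R.
    by rewrite ux powR0 ?gt_eqF//; exact: nneseries_ge0.
  have /asboolPn/existsp_asboolPn[i0 Hi0] : ~ forall i, (t i < u x)%R.
    by move=> H; apply: Nx => i _; split => //; exact: H.
  have ex : exists i, ~~ (t i < u x)%R by exists i0; exact/negP.
  case: (ex_minnP ex) => -[|i]; rewrite -leNgt => ti tmin.
    by move: ti; rewrite t0 => ti; rewrite eq_le ti u0 in ux.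
  have ti' : (t i < u x)%R.
    by rewrite ltNge; apply/negP; rewrite leNgt => /tmin; rewrite ltnn.
  apply: (@le_trans _ _ (g i x)).
    rewrite /g indicE mem_set// mulr1 lee_fin ge0_ler_powR ?nnegrE//; first exact: ltW.
    exact: le_trans ti.
  rewrite (nneseries_split 0 i.+1)// add0n big_nat_recr//= -addeA addeCA leeDl//.
  by rewrite adde_ge0// ?nneseries_ge0// sume_ge0.
rewrite integral_nneseries//; last by move=> i; exact: measurable_funTS.
apply: lime_le; first by apply: is_cvg_nneseries => *; exact: integral_ge0.
apply: nearW => I; apply: le_trans (_ : _ <= (\sum_(i < I) t i.+1 `^ q * b i)%R%:E) _.
  rewrite big_mkord -sumEFin; apply: lee_sum => i _.
  under eq_integral do rewrite /g EFinM.
  rewrite ge0_integralZl//; last 2 first.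
  - exact/measurable_EFinP/measurable_funTS/measurable_indic/measurable_over.
  - by rewrite lee_fin powR_ge0.
  rewrite integral_indic//; last exact: measurable_over.
  rewrite EFinM; apply: lee_wpmul2l; first by rewrite lee_fin powR_ge0.
  by rewrite setIidl//; move=> x [].
by rewrite lee_fin.
Qed.

End quantile.

(** * A discrete Hardy inequality *)

Section discrete_hardy.
Context {R : realType}.
Implicit Types (p q x y theta X : R).

(** Put [b i = theta ^+ i * t i.+1] and [g i = theta ^+ i * (t i.+1 - t i)], so that
    [b i.+1 = theta * b i + g i.+1]. By [powR_wconvex] the powers [b i `^ p] satisfy a
    recursion of the same form, which bounds both their supremum and their sum; the
    sum of the [b i `^ q] is at most the sum of the [b i `^ p] times the power
    [q / p - 1] of their supremum. *)
Lemma discrete_hardy p q theta X (t : nat -> R) : 1 <= p -> p <= q ->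
  0 < theta < 1 -> t 0%N = 0 -> (forall i, t i <= t i.+1) ->
  (forall I, \sum_(i < I) (t i.+1 - t i) `^ p * (theta `^ p) ^+ i <= X) ->
  forall I, \sum_(i < I) t i.+1 `^ q * (theta `^ q) ^+ i <=
    ((1 - theta) `^ (1 - p) * X) `^ (q / p) / (1 - theta).
Proof.
move=> p1 pq /[dup] th01 /andP[th0 th1] t0 ndt HX.
have p0 : 0 < p by exact: lt_le_trans p1.
have d0 : 0 < 1 - theta by rewrite subr_gt0.
pose gam := (1 - theta) `^ (1 - p).
have gam1 : 1 <= gam.
  rewrite -(powRr0 (1 - theta)); apply: ger_powR; last by rewrite subr_le0.
  by rewrite d0/= gerBl ltW.
pose g i := (t i.+1 - t i) `^ p * (theta `^ p) ^+ i.
have g0 i : 0 <= g i by rewrite mulr_ge0 ?powR_ge0 ?exprn_ge0 ?powR_ge0.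
have tge0 i : 0 <= t i by elim: i => [|i IH]; [rewrite t0|exact: le_trans IH _].
have thX x i : (theta `^ x) ^+ i = (theta ^+ i) `^ x.
  by rewrite -!powR_mulrn ?powR_ge0 ?(ltW th0)// -!powRrM mulrC.
have thi i : 0 <= theta ^+ i by rewrite exprn_ge0 ?ltW.
pose a i := (theta ^+ i * t i.+1) `^ p.
have a0 i : 0 <= a i by exact: powR_ge0.
have aS i : a i.+1 <= theta * a i + gam * g i.+1.
  rewrite /a /g thX -powRM ?subr_ge0//.
  apply: le_trans (powR_wconvex p1 th01 _ _); rewrite ?mulr_ge0 ?subr_ge0//.
  by rewrite le_eqVlt; apply/orP; left; apply/eqP; congr (_ `^ _); rewrite exprS; ring.
have a00 : a 0%N <= gam * g 0%N.
  by rewrite /a /g !expr0 mul1r mulr1 t0 subr0 ler_peMl ?powR_ge0.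
have asup i : a i <= gam * X.
  apply: (@le_trans _ _ (gam * \sum_(j < i.+1) g j)); last first.
    by apply: ler_wpM2l; [exact: le_trans gam1|exact: HX].
  elim: i => [|i IH]; first by rewrite big_ord_recr big_ord0/= add0r.
  apply: le_trans (aS i) _; rewrite big_ord_recr/= mulrDr lerD2r.
  by apply: le_trans IH; rewrite ler_piMl// ltW.
have asum I : \sum_(i < I) a i <= gam * X / (1 - theta).
  have X0 : 0 <= X by apply: le_trans (HX 0%N); rewrite big_ord0.
  case: I => [|I]; first by rewrite big_ord0 divr_ge0 ?(ltW d0)// mulr_ge0 ?powR_ge0.
  rewrite ler_pdivlMr// mulrBr mulr1 lerBlDr.
  apply: (@le_trans _ _ (gam * \sum_(i < I.+1) g i + theta * \sum_(i < I) a i)).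
    rewrite big_ord_recl [in leRHS]big_ord_recl !mulr_sumr mulrDr -addrA lerD//.
    rewrite mulr_sumr -big_split/=; apply: ler_sum => i _.
    by rewrite /bump/= add1n addrC.
  apply: lerD; first by apply: ler_wpM2l; [exact: le_trans gam1|exact: HX].
  by rewrite mulrC big_ord_recr/= ler_wpM2r ?(ltW th0)// lerDl.
have qp1 : 1 <= q / p by rewrite ler_pdivlMr// mul1r.
have gX0 : 0 <= gam * X by exact: le_trans (asup 0%N).
move=> I; rewrite (_ : _ / _ = (gam * X) `^ (q / p - 1) * (gam * X / (1 - theta))); last first.
  have [gX|gX] := eqVneq (gam * X) 0.
    by rewrite -/gam gX powR0 ?mul0r ?mulr0// gt_eqF// divr_gt0// (lt_le_trans p0).
  by rewrite -/gam mulrA powRB ?gX ?implybT// powRr1// divfK.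
apply: le_trans (ler_wpM2l _ (asum I)); last exact: powR_ge0.
rewrite mulr_sumr; apply: ler_sum => i _.
rewrite (_ : _ * _ = a i `^ (q / p)); last first.
  rewrite /a -powRrM (mulrC p) divfK ?gt_eqF// powRM// thX mulrC//.
have [ai|ai] := eqVneq (a i) 0.
  by rewrite ai mulr0 powR0// gt_eqF// divr_gt0// (lt_le_trans p0).
rewrite -[in leLHS](subrK 1 (q / p)) powRD ?ai ?implybT// powRr1//.
rewrite ler_wpM2r// ge0_ler_powR ?nnegrE ?subr_ge0//.
Qed.

End discrete_hardy.

(** * Dyadic sums of the weight *)

Section dyadic.
Context {R : realType}.
Variable r : R.
Hypothesis r0 : 0 < r.

Definition tau (k : nat) : R := 2 * r / 2 ^+ k.

Lemma tau_gt0 k : 0 < tau k.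
Proof. by rewrite /tau divr_gt0 ?mulr_gt0 ?exprn_gt0. Qed.

Lemma tauS k : tau k = 2 * tau k.+1.
Proof. by rewrite /tau exprS; field; rewrite expf_neq0. Qed.

Lemma tauD i k : tau k = 2 ^+ i * tau (i + k).
Proof. by rewrite /tau exprD; field; rewrite !expf_neq0. Qed.

Lemma tau1 : tau 1 = r.
Proof. by rewrite /tau expr1; field. Qed.

Lemma tau_lt e : 0 < e -> exists k, tau k < e.
Proof.
move=> e0; exists (Num.bound (2 * r / e)).
rewrite /tau ltr_pdivrMr ?exprn_gt0// (mulrC e) -ltr_pdivrMr//.
apply: lt_le_trans (unstable.ltr_bound _) _.
by rewrite -(natrX _ 2) ler_nat ltnW// ltn_expl.
Qed.

Lemma le_tau i k : (i <= k)%N -> tau k <= tau i.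
Proof.
move=> /subnK <-; rewrite (tauD (k - i) i) ler_peMl ?(ltW (tau_gt0 _))//.
by rewrite exprn_ege1// ler1n.
Qed.

(** These intervals partition the positive numbers below [2 * r]; on each of them
    (adec) bounds the weight from above by its value at the left end and from below
    by its value at the right end. *)
Definition shell (k : nat) : set R := `[tau k.+1, tau k[%classic.

Lemma measurable_shell k : measurable (shell k : set (measurableTypeR R)).
Proof. exact: measurable_itv. Qed.

Lemma leb_shell k : lebesgue_measure (shell k) = (tau k.+1)%:E.
Proof.
rewrite /shell lebesgue_measure_itv/= lte_fin ifT; last first.
  by rewrite (tauS k) ltr_pMl ?tau_gt0// ltr1n.
by rewrite -EFinB (tauS k); congr EFin; ring.
Qed.

Lemma shell_exists t : 0 < t < r -> exists2 k, (0 < k)%N & shell k t.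
Proof.
move=> /andP[t0 tr]; have [k0 Hk0] := tau_lt t0.
have ex : exists k, tau k <= t by exists k0; exact: ltW.
case: (ex_minnP ex) => -[|[|k]] kt kmin.
- by move: kt; rewrite tauS tau1; lra.
- by move: kt; rewrite tau1 leNgt tr.
exists k.+1 => //; rewrite /shell/= in_itv/= kt/= ltNge; apply/negP => /kmin.
by rewrite ltnn.
Qed.

Lemma shell_inj t i j : shell i t -> shell j t -> i = j.
Proof.
rewrite /shell/= !in_itv/= => /andP[ti it] /andP[tj jt].
apply/eqP; rewrite eqn_leq (leqNgt i) (leqNgt j); apply/andP; split;
  apply/negP => /le_tau H.
  by have := lt_le_trans it (le_trans H tj); rewrite ltxx.
by have := lt_le_trans jt (le_trans H ti); rewrite ltxx.
Qed.

End dyadic.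

Section weights.
Context {R : realType}.
Variables (s p L r : R) (phi : R -> R).
Hypotheses (s0 : 0 < s) (s1 : s < 1) (p1 : 1 < p) (L1 : 1 <= L) (r0 : 0 < r).
Hypothesis phi_gt0 : forall t, 0 < t -> 0 < phi t.
Hypothesis ad : adec s p L phi.

Local Notation tau := (tau r).
Local Notation shell := (shell r).
Let a := (1 - s) * p.
Let L0 : 0 < L. Proof. exact: lt_le_trans L1. Qed.
Let p0 : 0 < p. Proof. exact: lt_trans p1. Qed.
Let a0 : 0 <= a. Proof. by rewrite mulr_ge0 ?subr_ge0 ?ltW. Qed.

Lemma adecM x y : 0 < x -> x <= y -> phi y <= L * phi x * (y / x) `^ a.
Proof.
move=> x0 xy; have y0 := lt_le_trans x0 xy.
have := ad x0 xy; rewrite -/a ler_pdivrMr ?powR_gt0// => /le_trans; apply.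
by rewrite powR_divr ?(ltW x0) ?(ltW y0)// !mulrA (mulrAC _ (y `^ a)).
Qed.

Let phit0 k : 0 <= phi (tau k). Proof. by rewrite ltW// phi_gt0// tau_gt0. Qed.

Let phit t : 0 < t -> 0 <= phi t / t.
Proof. by move=> t0; rewrite divr_ge0// ltW// phi_gt0. Qed.

Let taut0 k : 0 <= tau k. Proof. by rewrite ltW// tau_gt0. Qed.

Lemma phi_tauD i k : L^-1 * (2 `^ (- a)) ^+ i * phi (tau k) <= phi (tau (i + k)).
Proof.
have := adecM (tau_gt0 r0 (i + k)) (le_tau r0 (leq_addl i k)).
rewrite {2}(tauD r i k) mulfK ?gt_eqF ?tau_gt0//.
have E : (2 `^ (- a)) ^+ i = ((2 ^+ i) `^ a)^-1.
  by rewrite -powR_mulrn ?powR_ge0// -powRrM mulNr powRN mulrC powRrM powR_mulrn.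
move=> H; rewrite E -mulrA ler_pdivrMl// ler_pdivrMl ?powR_gt0 ?exprn_gt0//.
by rewrite mulrC.
Qed.

Lemma phi_shell_le k t : shell k t -> phi t / t <= L * 2 `^ p * phi (tau k.+1) / tau k.+1.
Proof.
rewrite /shell/= in_itv/= => /andP[kt tk]; have tk0 := tau_gt0 r0 k.+1.
have t0 := lt_le_trans tk0 kt.
apply: ler_pM; rewrite ?invr_ge0 ?(ltW t0) ?(ltW (phi_gt0 t0))//; last first.
  by rewrite lef_pV2 ?posrE.
apply: le_trans (adecM tk0 kt) _; rewrite -[leRHS]mulrA (mulrC (2 `^ p)) mulrA.
apply: ler_wpM2l; first by rewrite mulr_ge0 ?(ltW L0)// ltW// phi_gt0.
apply: (@le_trans _ _ (2 `^ a)).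
  apply: ge0_ler_powR; rewrite ?nnegrE//; first exact: divr_ge0 (ltW t0) (ltW tk0).
  by rewrite ler_pdivrMr// -tauS// ltW.
by apply: ler_powR; rewrite ?ler1n// /a ler_piMl ?(ltW p0)// gerBl ltW.
Qed.

Lemma phi_shell_ge k t : shell k t ->
  (L * 2 `^ p)^-1 * phi (tau k) / tau k <= phi t / t.
Proof.
rewrite /shell/= in_itv/= => /andP[kt tk]; have tk0 := tau_gt0 r0 k.+1.
have t0 := lt_le_trans tk0 kt.
apply: ler_pM; rewrite ?invr_ge0 ?(ltW (tau_gt0 r0 k))//; last first.
- by rewrite lef_pV2 ?posrE ?tau_gt0// ltW.
- rewrite ler_pdivrMl ?mulr_gt0 ?powR_gt0//.
  apply: le_trans (adecM t0 (ltW tk)) _; rewrite -[leRHS]mulrA (mulrC (2 `^ p)) mulrA.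
  apply: ler_wpM2l; first by rewrite mulr_ge0 ?(ltW L0)// ltW// phi_gt0.
  apply: (@le_trans _ _ (2 `^ a)).
    apply: ge0_ler_powR; rewrite ?nnegrE//.
      exact: divr_ge0 (ltW (tau_gt0 r0 _)) (ltW t0).
    by rewrite ler_pdivrMr// (tauS r k) ler_pM2l.
  by apply: ler_powR; rewrite ?ler1n// /a ler_piMl ?(ltW p0)// gerBl ltW.
- by rewrite mulr_ge0// invr_ge0 mulr_ge0 ?powR_ge0// ltW.
Qed.

Lemma sum_shell_le (x : nat -> R) (i N : nat) t y : 0 <= y ->
  (forall k, shell k t -> x k <= y) ->
  \sum_(i <= k < N) x k * \1_(shell k) t <= y.
Proof.
move=> y0 xy; have [[k [kiN kt]]|nk] :=
    pselect (exists k, k \in index_iota i N /\ shell k t).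
  rewrite (bigD1_seq k)//= ?iota_uniq// indicE mem_set// mulr1 big1 ?addr0 ?xy// => j jk.
  rewrite indicE memNset ?mulr0// => /(shell_inj r0 kt) kj.
  by rewrite kj eqxx in jk.
rewrite big_seq big1// => k kiN; rewrite indicE memNset ?mulr0// => kt.
by apply: nk; exists k.
Qed.

Lemma integral_phi_shells_ge (D : set R) (i N : nat) : measurable D ->
  (forall k, (i <= k)%N -> shell k `<=` D) -> (forall t, D t -> 0 < t) ->
  (((L * 2 `^ p)^-1 / 2 * \sum_(i <= k < N) phi (tau k))%:E <=
   \int[lebesgue_measure]_(t in D) (phi t / t)%:E)%E.
Proof.
move=> mD sD D0; set c := (L * 2 `^ p)^-1.
have c0 : 0 <= c by rewrite invr_ge0 mulr_ge0 ?powR_ge0// ltW.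
have x0 k : 0 <= c * phi (tau k) / tau k.
  by apply: divr_ge0 => //; exact: mulr_ge0.
apply: (@le_trans _ _ (\int[lebesgue_measure]_(t in D)
    (\sum_(i <= k < N) (c * phi (tau k) / tau k * \1_(shell k) t)%:E))%E); last first.
  apply: le_integral_nomeas => t Dt.
    by apply: sume_ge0 => k _; rewrite lee_fin mulr_ge0.
  rewrite sumEFin lee_fin; apply: sum_shell_le => [|k]; last exact: phi_shell_ge.
  exact: phit (D0 _ Dt).
rewrite ge0_integral_sum//; last 2 first.
- move=> k; apply/measurable_EFinP/measurable_funM => //.
  by apply: measurable_indic; exact: measurable_shell.
- by move=> k t _; rewrite lee_fin mulr_ge0.
rewrite mulr_sumr -sumEFin big_nat_cond [leRHS]big_nat_cond.
apply: lee_sum => k /andP[/andP[ik _] _].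
under eq_integral do rewrite EFinM.
rewrite ge0_integralZl//; last 2 first.
- by apply/measurable_EFinP; apply: measurable_indic; exact: measurable_shell.
- by rewrite lee_fin.
rewrite integral_indic//; last exact: measurable_shell.
rewrite setIidl; last exact: sD.
rewrite [X in (_ * X)%E](_ : _ = (tau k.+1)%:E); last exact: leb_shell.
rewrite -EFinM lee_fin (tauS r k) le_eqVlt; apply/orP; left; apply/eqP.
by field; rewrite gt_eqF ?tau_gt0.
Qed.

Lemma integral_phi_shells_le :
  (\int[lebesgue_measure]_(t in `]0%R, r[) (phi t / t)%:E <=
   \sum_(0 <= k <oo) (L * 2 `^ p * phi (tau k.+1))%:E)%E.
Proof.
pose x k := L * 2 `^ p * phi (tau k.+1) / tau k.+1.
have x0 k : 0 <= x k.
  by apply: divr_ge0 => //; rewrite !mulr_ge0 ?powR_ge0// ltW.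
pose g k (t : measurableTypeR R) := (x k * \1_(shell k) t)%:E.
have g0 k t : (0 <= g k t)%E by rewrite lee_fin mulr_ge0.
have mg k : measurable_fun (setT : set (measurableTypeR R)) (g k).
  apply/measurable_EFinP/measurable_funM => //.
  by apply: measurable_indic; exact: measurable_shell.
apply: (@le_trans _ _ (\int[lebesgue_measure]_(t in `]0%R, r[) (\sum_(0 <= k <oo) g k t))%E).
  apply: le_integral_nomeas => t; rewrite /= in_itv/= => tr.
    by have /andP[t0 _] := tr; rewrite lee_fin phit.
  have [k k0 kt] := shell_exists tr.
  apply: (@le_trans _ _ (g k t)).
    by rewrite /g indicE mem_set// mulr1 lee_fin phi_shell_le.
  rewrite (nneseries_split 0 k.+1)// add0n big_nat_recr//= -addeA addeCA leeDl//.
  by rewrite adde_ge0// ?nneseries_ge0// sume_ge0.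
rewrite integral_nneseries//; last by move=> k; exact: measurable_funTS.
apply: lee_nneseries => [k _ _|k _].
  by apply: integral_ge0 => t _; exact: g0.
under eq_integral do rewrite /g EFinM.
rewrite ge0_integralZl//; last 2 first.
- by apply/measurable_EFinP; apply: measurable_indic; exact: measurable_shell.
- by rewrite lee_fin.
rewrite integral_indic//; last exact: measurable_shell.
apply: (@le_trans _ _ ((x k)%:E * lebesgue_measure (shell k))%E).
  apply: lee_wpmul2l; first by rewrite lee_fin.
  apply: le_measure; rewrite ?inE; [|exact: measurable_shell|by move=> ? []].
  by apply: measurableI; [exact: measurable_shell|exact: measurable_itv].
rewrite [X in (_ * X)%E](_ : _ = (tau k.+1)%:E); last exact: leb_shell.
by rewrite -EFinM /x divfK// gt_eqF// tau_gt0.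
Qed.

(** (Dini) makes the sum of the [phi (tau k)] finite, hence also [Phi phi r], so that
    the latter is positive and not the default value of a divergent integral; a long
    enough partial sum exceeds half of the sum, whence the factor 2. *)
Lemma Phi_bound : Dini phi -> exists M,
  0 < Phi phi r /\ Phi phi r <= 2 * L * 2 `^ p * \sum_(k < M) phi (tau k).
Proof.
move=> din; pose C := L * 2 `^ p.
have C0 : 0 < C by rewrite mulr_gt0 ?powR_gt0.
(* From scale [i] on, the shells lie in the domain of the Dini integral. *)
have [i ti] := tau_lt r (ltr01 : 0 < 1 :> R).
have Sbd N : \sum_(i <= k < N) phi (tau k) <=
    2 * C * fine (\int[lebesgue_measure]_(t in `]0%R, 1%R[) (phi t / t)%:E).
  have D0 : (0 <= \int[lebesgue_measure]_(t in `]0%R, 1%R[) (phi t / t)%:E)%E.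
    apply: integral_ge0 => t; rewrite /= in_itv/= => /andP[t0 _].
    by rewrite lee_fin divr_ge0 ?(ltW t0)// ltW// phi_gt0.
  have := @integral_phi_shells_ge `]0%R, 1%R[%classic i N (measurable_itv _) _ _.
  move=> /(_ _ _)/wrap[].
  - move=> k ik t; rewrite /shell/= !in_itv/= => /andP[kt tk].
    rewrite (lt_le_trans (tau_gt0 r0 _) kt)/= (lt_le_trans tk)//.
    exact: ltW (le_lt_trans (le_tau r0 ik) ti).
  - by move=> t; rewrite /= in_itv/= => /andP[].
  rewrite -[X in (_ <= X)%E]fineK ?ge0_fin_numE// lee_fin -/C.
  by rewrite -invfM ler_pdivrMl ?mulr_gt0// (mulrC C).
pose A := \sum_(0 <= k < i) phi (tau k) +
  2 * C * fine (\int[lebesgue_measure]_(t in `]0%R, 1%R[) (phi t / t)%:E).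
have SA N : \sum_(k < N) phi (tau k.+1) <= A.
  apply: (@le_trans _ _ (\sum_(0 <= k < i + N.+1) phi (tau k))); last first.
    by rewrite (big_cat_nat (n := i))//= ?leq_addr// lerD2l.
  rewrite (big_cat_nat (n := N.+1))//= ?leq_addl// big_nat_recl//= big_mkord.
  by rewrite -addrA addrCA lerDl addr_ge0// sumr_ge0.
have f0E k : (0 <= (phi (tau k.+1))%:E)%E by rewrite lee_fin.
pose Se := (\sum_(0 <= k <oo) (phi (tau k.+1))%:E)%E.
have SeA : (Se <= A%:E)%E.
  apply: lime_le; first by apply: is_cvg_nneseries => *; exact: f0E.
  by apply: nearW => N; rewrite big_mkord sumEFin lee_fin.
have Se0 : (0 <= Se)%E by apply: nneseries_ge0 => *; exact: f0E.
have Sefin : Se \is a fin_num by rewrite ge0_fin_numE// (le_lt_trans SeA)// ltry.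
set I := (\int[lebesgue_measure]_(t in `]0%R, r[) (phi t / t)%:E)%E.
have I0 : (0 < I)%E.
  have := @integral_phi_shells_ge `]0%R, r[%classic 1 2 (measurable_itv _).
  move=> /(_ _ _)/wrap[].
  - move=> k k1 t; rewrite /shell/= !in_itv/= => /andP[kt tk].
    rewrite (lt_le_trans (tau_gt0 r0 _) kt)/= (lt_le_trans tk)//.
    by have := le_tau r0 k1; rewrite tau1.
  - by move=> t; rewrite /= in_itv/= => /andP[].
  apply: lt_le_trans; rewrite big_nat1 lte_fin mulr_gt0 ?divr_gt0 ?invr_gt0//.
  by rewrite phi_gt0// tau_gt0.
have ISe : (I <= C%:E * Se)%E.
  apply: le_trans integral_phi_shells_le _; by rewrite -nneseriesZl.
have Ifin : I \is a fin_num.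
  by rewrite ge0_fin_numE ?ltW// (le_lt_trans ISe)// -(fineK Sefin) -EFinM ltry.
have PhiE : Phi phi r = fine I by [].
have Phi0 : 0 < Phi phi r by rewrite PhiE fine_gt0// I0/= -ge0_fin_numE// ltW.
have PhiSe : Phi phi r <= C * fine Se.
  by rewrite PhiE -lee_fin EFinM !fineK.
have [M SM] : exists M, fine Se / 2 < \sum_(k < M) phi (tau k.+1).
  apply: contrapT => nM; have : (Se <= (fine Se / 2)%:E)%E.
    apply: lime_le; first by apply: is_cvg_nneseries => *; exact: f0E.
    apply: nearW => N; rewrite big_mkord sumEFin lee_fin leNgt; apply/negP => H.
    by apply: nM; exists N.
  rewrite -{1}(fineK Sefin) lee_fin => H.
  have : 0 < C * fine Se by exact: lt_le_trans PhiSe.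
  by rewrite pmulr_rgt0//; lra.
exists M.+1; split => //; apply: (le_trans PhiSe).
rewrite [leRHS](_ : _ = C * (2 * \sum_(k < M.+1) phi (tau k))); last by rewrite /C; ring.
rewrite ler_wpM2l ?(ltW C0)//.
have : \sum_(k < M) phi (tau k.+1) <= \sum_(k < M.+1) phi (tau k).
  by rewrite [leRHS]big_ord_recl lerDr.
by lra.
Qed.

(** A geometric progression whose last nonzero term is less than [y]. *)
Lemma sum_pow2_below N (y : R) : 0 <= y ->
  \sum_(k < N) (2 ^+ k < y)%R%:R * 2 ^+ k <= 2 * y.
Proof.
move=> y0; elim: N => [|N IH]; first by rewrite big_ord0 mulr_ge0.
rewrite big_ord_recr/=; have [Ny|Ny] := ltP (2 ^+ N) y; last by rewrite mul0r addr0.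
rewrite mul1r; have H : \sum_(k < N) (2 ^+ k < y)%R%:R * 2 ^+ k <= 2 ^+ N :> R.
  clear Ny IH; elim: N => [|N IH]; first by rewrite big_ord0 expr0.
  rewrite big_ord_recr/= exprS mulr2n mulrDl !mul1r lerD//.
  by rewrite ler_piMl ?exprn_ge0// lern1 leq_b1.
lra.
Qed.

(** The terms with [d < tau k] decay geometrically as [tau k] grows: by (adec) the
    weight grows at most like the power [(1 - s) * p <= n + p - 1] of [tau k], and
    each term carries the power [- (n + p)] of [tau k]. *)
Lemma multiscale_le n N d : (0 < n)%N -> 0 < d ->
  multiscale (n := n) r p (fun k => phi (tau k)) N d <=
  2 * L * (2 * r) `^ (n%:R + p) * (phi d / d `^ p / d ^+ n).
Proof.
move=> n0 d0; have r20 : 0 < 2 * r by rewrite mulr_gt0.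
set K := L * (2 * r) `^ (n%:R + p) * (phi d / d `^ p / d ^+ n).
have K0 : 0 <= K.
  rewrite /K !mulr_ge0 ?invr_ge0 ?powR_ge0 ?exprn_ge0 ?(ltW d0) ?(ltW L0)//.
  by rewrite ltW// phi_gt0.
(* Now [d < tau k] reads [2 ^+ k < y], and [d / tau k] is [2 ^+ k / y]. *)
pose y := 2 * r / d.
have y0 : 0 < y by rewrite divr_gt0.
apply: (@le_trans _ _ (K * y^-1 * (2 * y))); last first.
  by rewrite /K le_eqVlt; apply/orP; left; apply/eqP; field; rewrite !gt_eqF ?exprn_gt0 ?powR_gt0.
apply: (@le_trans _ _ (K * y^-1 * \sum_(k < N) (2 ^+ k < y)%R%:R * 2 ^+ k)); last first.
  by apply: ler_wpM2l; [rewrite mulr_ge0// invr_ge0 ltW|exact: sum_pow2_below (ltW y0)].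
rewrite mulr_sumr; apply: ler_sum => k _; rewrite /near_ind -/(tau k).
have tk0 := tau_gt0 r0 k.
have k20 : 0 < 2 ^+ k :> R by rewrite exprn_gt0.
have E : (d < tau k) = (2 ^+ k < y).
  by rewrite /y ltr_pdivlMr// mulrC -ltr_pdivlMr.
rewrite E; case: ltP; rewrite ?mulr0 ?mul0r ?mulr0// -E => dt.
rewrite mulr1 mul1r.
set X := tau k / d; have X0 : 0 < X by rewrite divr_gt0.
have X1 : 1 <= X by rewrite ler_pdivlMr// mul1r ltW.
have yX : 2 ^+ k = y / X by rewrite /y /X /tau; field; rewrite !gt_eqF.
have DE : (2 ^+ n * 2 `^ p) ^+ k = y `^ (n%:R + p) * X `^ (- (n%:R + p)).
  have -> : 2 ^+ n * 2 `^ p = 2 `^ (n%:R + p) :> R.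
    by rewrite powRD ?pnatr_eq0 ?implybT// powR_mulrn.
  rewrite -powR_mulrn ?powR_ge0// -powRrM mulrC powRrM powR_mulrn// yX.
  by rewrite powR_divr ?(ltW y0) ?(ltW X0)// powRN.
rewrite DE yX.
have -> : K * y^-1 * (y / X) = L * phi d * y `^ (n%:R + p) * X^-1.
  rewrite /K /y powR_divr ?(ltW d0) ?(ltW r20)// [d `^ (_ + _)]powRD ?(gt_eqF d0) ?implybT// powR_mulrn ?(ltW d0)//.
  field; rewrite !gt_eqF ?powR_gt0 ?exprn_gt0//.
apply: (@le_trans _ _ (L * phi d * X `^ a * (y `^ (n%:R + p) * X `^ (- (n%:R + p))))).
  by apply: ler_wpM2r; [rewrite mulr_ge0 ?powR_ge0|exact: adecM (ltW dt)].
rewrite -!mulrA ler_wpM2l ?(ltW L0)// ler_wpM2l ?(ltW (phi_gt0 d0))//.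
rewrite mulrCA ler_wpM2l ?powR_ge0// -powRD ?(gt_eqF X0) ?implybT//.
rewrite -powR_inv1 ?(ltW X0)//; apply: ler_powR => //.
have : a <= p by rewrite /a ler_piMl ?(ltW p0)// gerBl ltW.
have : 1 <= n%:R :> R by rewrite ler1n.
lra.
Qed.

End weights.

(** * From levels to medians, from medians to the mean *)

Section superlevel_Lq.
Context {R : realType} {n : nat}.
Variables (x0 : n.-tuple R) (r p q c rho theta E : R) (f : nat -> R) (M : nat).
Hypotheses (n0 : (0 < n)%N) (r0 : 0 < r) (p1 : 1 < p) (pq : p <= q).
Hypotheses (c0 : 0 < c) (rho0 : 0 <= rho) (f0 : forall k, 0 <= f k).
Hypothesis frho : forall i k, c * rho ^+ i * f k <= f (i + k)%N.
Hypothesis SM : 0 < \sum_(k < M) f k.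
Hypothesis th01 : 0 < theta < 1.
Hypothesis thp : theta `^ p = 2 `^ p * rho / 2 ^+ n.
Hypothesis thq : theta `^ q = (2 ^+ n)^-1.

Local Notation B := (eball x0 r).
Local Notation V := (vol (eball x0 r)).

Lemma vol_gt0 : 0 < V.
Proof.
rewrite /vol fine_gt0// leb_eball_lty// andbT.
apply: lt_le_trans (leb_eball_ge x0 n0 r0).
by rewrite lte_fin exprn_gt0// mulr_gt0// divr_gt0// ltr0n.
Qed.

(** Bound for the average of the q-th power, in the form in which [discrete_hardy]
    produces it from the constant of [level_energy]. *)
Definition energy_factor : R :=
  ((1 - theta) `^ (1 - p) * (E / ((V / 2) ^+ 2 / 2 ^+ n * c * \sum_(k < M) f k)))
    `^ (q / p) / (1 - theta).

(** The levels are 0 followed by the quantiles for the measures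
    [V / 2 / (2 ^+ n) ^+ i]; the hypotheses on [theta] turn the weights of
    [level_energy] into those of [discrete_hardy]. *)
Lemma superlevel_Lq (u : n.-tuple R -> R) : measurable_fun setT u ->
  (forall x, 0 <= u x) ->
  (leb n (B `&` [set x | (0 < u x)%R]) <= (V / 2)%:E)%E ->
  (forall N, (kenergy x0 r p (multiscale (n := n) r p f N) u <= E%:E)%E) ->
  (\int[leb n]_(x in B) (u x `^ q)%:E <= (V / 2 * energy_factor)%:E)%E.
Proof.
move=> mu u0 umed uE.
have mB := measurable_eball x0 r; have V0 := vol_gt0.
have Boo : (leb n B < +oo)%E by exact: leb_eball_lty.
have qn0 : 0 < 2 ^+ n :> R by rewrite exprn_gt0.
have qn1 : 1 < 2 ^+ n :> R by rewrite exprn_egt1 ?ltr1n// -lt0n.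
pose b i := V / 2 / (2 ^+ n) ^+ i.
have b0 i : 0 < b i by rewrite !divr_gt0// exprn_gt0.
have bS i : b i.+1 <= b i.
  rewrite /b ler_wpM2l ?divr_ge0 ?(ltW V0)// lef_pV2 ?posrE ?exprn_gt0//.
  by rewrite exprS ler_peMl ?exprn_ge0 ?(ltW qn0)// ltW.
have bB i : ((b i)%:E < leb n B)%E.
  rewrite leb_ball// lte_fin (@le_lt_trans _ _ (b 0%N))//.
    by elim: i => // i IH; exact: le_trans (bS i) IH.
  by rewrite /b expr0 divr1; lra.
pose t i := if i is 0%N then 0 else quantile (leb n) B u (b i).
have ndt i : t i <= t i.+1.
  case: i => [|i] /=; first exact: quantile_ge0.
  exact: le_quantile.
have tub i : (leb n (B `&` [set x | (t i < u x)%R]) <= (b i)%:E)%E.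
  case: i => [|i] /=; first by rewrite /b expr0 divr1.
  exact: over_quantile.
have tlb i : ((b i.+1)%:E <= leb n (B `&` [set x | (t i.+1 <= u x)%R]))%E.
  exact: under_quantile.
have p0 : 0 < p by exact: lt_trans p1.
have A0 : 0 < (V / 2) ^+ 2 / 2 ^+ n * c * \sum_(k < M) f k.
  by rewrite !mulr_gt0 ?invr_gt0 ?exprn_gt0// divr_gt0.
have HX I : \sum_(i < I) (t i.+1 - t i) `^ p * (theta `^ p) ^+ i <=
    E / ((V / 2) ^+ 2 / 2 ^+ n * c * \sum_(k < M) f k).
  rewrite ler_pdivlMr// -lee_fin; apply: le_trans (uE (I + M)%N).
  rewrite mulr_suml thp; apply: level_energy => //; exact: ltW.
have HH := discrete_hardy (ltW p1) pq th01 (erefl : t 0%N = 0) ndt HX.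
apply: (@integral_powR_levels _ _ _ (leb n) _ _ mB mu q t b) => //.
- exact: lt_le_trans pq.
- rewrite /b; under eq_fun do rewrite -exprVn.
  apply: cvg_geometric; rewrite ger0_norm ?invr_ge0 ?(ltW qn0)//.
  by rewrite invf_lt1.
- move=> I; apply: le_trans (ler_wpM2l _ (HH I)); last by rewrite divr_ge0 ?(ltW V0).
  rewrite mulr_sumr thq; apply: ler_sum => i _.
  by rewrite /b exprVn mulrCA.
Qed.

Lemma kenergy_le k u w : (forall d, 0 <= k d) ->
  (forall x y, `|u x - u y| <= `|w x - w y|) ->
  (kenergy x0 r p k u <= kenergy x0 r p k w)%E.
Proof.
move=> k0 uw; apply: le_dint => x y; first exact: kform_ge0.
apply: ler_wpM2l; first by rewrite mulr_ge0.
apply: ler_wpM2l => //.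
by rewrite ge0_ler_powR ?nnegrE// ltW// (lt_trans _ p1).
Qed.

(** [superlevel_Lq] is applied to the positive parts of [w - m] and [- w - m'], where
    [m] and [- m'] are the lower and the upper median of [w]. As [m <= - m'], their
    maximum dominates [|w - m|]. *)
Lemma median_Lq (w : n.-tuple R -> R) : measurable_fun setT w ->
  (forall N, (kenergy x0 r p (multiscale (n := n) r p f N) w <= E%:E)%E) ->
  exists m, (\int[leb n]_(x in B) (`|w x - m| `^ q)%:E <= (V * energy_factor)%:E)%E.
Proof.
move=> mw wE.
have mB := measurable_eball x0 r; have V0 := vol_gt0.
have Boo : (leb n B < +oo)%E by exact: leb_eball_lty.
have h0 : 0 < V / 2 by rewrite divr_gt0.
have hB : ((V / 2)%:E < leb n B)%E by rewrite leb_ball// lte_fin; lra.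
have mNw : measurable_fun setT (fun x => - w x) by exact: measurable_funN.
pose m := quantile (leb n) B w (V / 2).
pose m' := quantile (leb n) B (fun x => - w x) (V / 2).
(* The points where [w < m] have measure at most half of that of the ball. *)
have mm' : m' <= - m.
  apply: ge_inf; first exact: quantile_set_lb.
  rewrite /= /over.
  have -> : B `&` [set x | - m < - w x] = B `\` (B `&` [set x | m <= w x]).
    apply/seteqP; split => x /= [Bx]; rewrite ?ltrN2.
      by move=> wm; split => // -[_]; rewrite leNgt wm.
    by move=> H; split => //; rewrite ltNge; apply/negP => ?; apply: H.
  rewrite measureD//; last first.
    apply: measurableI => //; rewrite -[X in measurable X]setTI.
    exact: measurable_fun_le.
  rewrite setIA setIid [X in (X - _ <= _)%E](_ : _ = V%:E); last exact: leb_ball.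
  have := under_quantile mB Boo mw h0 hB; rewrite -/m => H.
  apply: (@le_trans _ _ (V%:E - (V / 2)%:E)%E); first by rewrite leeB.
  by rewrite -EFinB lee_fin; lra.
pose u1 x := Num.max (w x - m) 0.
pose u2 x := Num.max (- w x - m') 0.
have mu1 : measurable_fun setT u1 by apply: measurable_maxr => //; exact: measurable_funB.
have mu2 : measurable_fun setT u2 by apply: measurable_maxr => //; exact: measurable_funB.
have u10 x : 0 <= u1 x by rewrite le_max lexx orbT.
have u20 x : 0 <= u2 x by rewrite le_max lexx orbT.
have I1 : (\int[leb n]_(x in B) (u1 x `^ q)%:E <= (V / 2 * energy_factor)%:E)%E.
  apply: (superlevel_Lq mu1 u10).
    have := over_quantile mB Boo mw h0 hB; rewrite /over -/m.
    rewrite (_ : [set x | m < w x] = [set x | 0 < u1 x])//.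
    by apply/seteqP; split => x; rewrite /= /u1 lt_max ltxx orbF subr_gt0.
  move=> N; apply: le_trans (wE N); apply: kenergy_le => [d|x y].
    exact: multiscale_ge0.
  apply: le_trans (maxr0_lip _ _) _.
  by rewrite [X in `|X|](_ : _ = w x - w y)//; ring.
have I2 : (\int[leb n]_(x in B) (u2 x `^ q)%:E <= (V / 2 * energy_factor)%:E)%E.
  apply: (superlevel_Lq mu2 u20).
    have := over_quantile mB Boo mNw h0 hB; rewrite /over -/m'.
    rewrite (_ : [set x | m' < - w x] = [set x | 0 < u2 x])//.
    by apply/seteqP; split => x; rewrite /= /u2 lt_max ltxx orbF subr_gt0.
  move=> N; apply: le_trans (wE N); apply: kenergy_le => [d|x y].
    exact: multiscale_ge0.
  apply: le_trans (maxr0_lip _ _) _.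
  by rewrite [X in `|X|](_ : _ = - (w x - w y)) ?normrN//; ring.
have q0 : 0 < q by apply: lt_le_trans pq; exact: lt_trans p1.
exists m; apply: (@le_trans _ _ (\int[leb n]_(x in B) ((u1 x `^ q)%:E + (u2 x `^ q)%:E))%E).
  apply: le_integral_nomeas => x _; first by rewrite lee_fin powR_ge0.
  rewrite -EFinD lee_fin; have [wm|wm] := leP m (w x).
    rewrite ler_wpDr ?powR_ge0// ger0_norm ?subr_ge0//.
    by rewrite ge0_ler_powR ?nnegrE ?subr_ge0 ?(ltW q0)// le_max lexx.
  rewrite ler_wpDl ?powR_ge0// ltr0_norm ?subr_lt0//.
  rewrite ge0_ler_powR ?nnegrE ?(ltW q0)//; first by rewrite oppr_ge0 subr_le0 ltW.
  by rewrite le_max; apply/orP; left; lra.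
have mpow (g : n.-tuple R -> R) : measurable_fun setT g ->
    measurable_fun B (fun x => (g x `^ q)%:E).
  move=> mg; apply/measurable_EFinP; apply: measurable_funTS.
  exact: (measurableT_comp (measurable_powR _)).
rewrite ge0_integralD//; try by [move=> x _; rewrite lee_fin powR_ge0|exact: mpow].
by apply: le_trans (leeD I1 I2) _; rewrite -EFinD lee_fin -mulrDl -splitr.
Qed.

End superlevel_Lq.

Section mean_oscillation.
Context {R : realType} {n : nat}.
Variables (B : set (n.-tuple R)) (q Y m : R) (w : n.-tuple R -> R).
Hypotheses (mB : measurable B) (V0 : 0 < vol B) (Boo : (leb n B < +oo)%E).
Hypotheses (q1 : 1 < q) (Y0 : 0 <= Y) (mw : measurable_fun setT w).
Hypothesis HY : (\int[leb n]_(x in B) (`|w x - m| `^ q)%:E <= (vol B * Y)%:E)%E.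

Let q0 : 0 < q. Proof. exact: lt_trans q1. Qed.

Let g x := `|w x - m|.

Let mg : measurable_fun setT g.
Proof. by apply: measurableT_comp => //; exact: measurable_funB. Qed.

Let lebB : leb n B = (vol B)%:E.
Proof. by rewrite /vol fineK// ge0_fin_numE. Qed.

Let intcst (k : R) : (\int[leb n]_(x in B) k%:E = (k * vol B)%:E)%E.
Proof. by rewrite integral_cst// EFinM; congr (_ * _)%E; exact: lebB. Qed.

(** Pointwise [g <= lam + lam `^ (1 - q) * g `^ q], according to whether [g <= lam]. *)
Lemma integral_dist_le lam : 0 < lam ->
  (\int[leb n]_(x in B) (g x)%:E <= (vol B * (lam + Y * lam `^ (1 - q)))%:E)%E.
Proof.
move=> l0; have lq0 : 0 <= lam `^ (1 - q) by exact: powR_ge0.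
apply: (@le_trans _ _ (\int[leb n]_(x in B)
   (lam%:E + (lam `^ (1 - q))%:E * (g x `^ q)%:E))%E).
  apply: le_integral_nomeas => x _; first by rewrite lee_fin normr_ge0.
  rewrite -EFinM -EFinD lee_fin; have [gl|gl] := leP (g x) lam.
    by rewrite ler_wpDr// mulr_ge0// powR_ge0.
  have gx0 : 0 < g x by exact: lt_trans gl.
  rewrite ler_wpDl ?(ltW l0)// -{1}(powRr1 (ltW gx0)) -[X in _ `^ X](subrK q 1).
  rewrite powRD ?(gt_eqF gx0) ?implybT// ler_wpM2r ?powR_ge0//.
  rewrite -opprB !powRN lef_pV2 ?posrE ?powR_gt0//.
  by rewrite ge0_ler_powR ?nnegrE ?subr_ge0 ?(ltW q1) ?(ltW l0) ?(ltW gx0) ?(ltW gl).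
have mgq : measurable_fun B (fun x => (g x `^ q)%:E).
  apply/measurable_EFinP; apply: measurable_funTS.
  exact: (measurableT_comp (measurable_powR _)).
rewrite ge0_integralD//; last 3 first.
- by move=> x _; rewrite lee_fin ltW.
- by move=> x _; rewrite mule_ge0 ?lee_fin ?powR_ge0.
- exact: measurable_funeM.
rewrite intcst ge0_integralZl//; last by move=> x _; rewrite lee_fin powR_ge0.
rewrite mulrDr EFinD leeD//; first by rewrite mulrC.
apply: (@le_trans _ _ ((lam `^ (1 - q))%:E * (vol B * Y)%:E)%E).
  by apply: lee_wpmul2l; [rewrite lee_fin|exact: HY].
by rewrite -EFinM lee_fin mulrC mulrA.
Qed.

Lemma integrable_dist : (leb n).-integrable B (EFin \o g).
Proof.
apply/integrableP; split; first exact/measurable_EFinP/measurable_funTS.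
rewrite (eq_integral (EFin \o g)).
  by apply: le_lt_trans (integral_dist_le ltr01) _; rewrite ltry.
by move=> x _ /=; rewrite normr_id.
Qed.

Lemma integrable_cstB (k : R) : (leb n).-integrable B (EFin \o cst k).
Proof.
apply/integrableP; split; first by apply/measurable_EFinP; exact: measurable_cst.
by under eq_integral do rewrite /=; rewrite intcst ltry.
Qed.

Lemma integrable_sub : (leb n).-integrable B (EFin \o (fun x => m - w x)).
Proof.
apply: (le_integrable mB _ _ integrable_dist).
  by apply/measurable_EFinP/measurable_funTS/measurable_funB.
by move=> x _ /=; rewrite lee_fin /g normr_id distrC.
Qed.

Lemma mean_dist_lam lam : 0 < lam ->
  `|m - mean B w| <= lam + Y * lam `^ (1 - q).
Proof.
move=> l0.
have E : m - mean B w = (vol B)^-1 * \int[leb n]_(x in B) (m - w x).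
  have iw : (leb n).-integrable B (EFin \o w).
    rewrite (_ : EFin \o w = ((EFin \o cst m) \- (EFin \o (fun x => (m - w x)%R)))%E).
      exact: integrableB (integrable_cstB m) integrable_sub.
    by apply/funext => x /=; rewrite -EFinB subKr.
  rewrite (RintegralB mB (integrable_cstB m) iw) Rintegral_cst// /mean mulrBr.
  by rewrite -/(vol B) mulrCA mulVf ?gt_eqF// mulr1.
rewrite E normrM gtr0_norm ?invr_gt0// ler_pdivrMl//.
apply: le_trans (le_normr_Rintegral mB integrable_sub) _.
rewrite -lee_fin; apply: le_trans (integral_dist_le l0).
rewrite /Rintegral fineK.
  by rewrite (eq_integral (fun x => (g x)%:E))// => x _; rewrite /g distrC.
have /integrableP[_] := integrable_sub.
by rewrite ge0_fin_numE//; apply: integral_ge0 => x _; rewrite lee_fin normr_ge0.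
Qed.

(** Jensen's inequality up to the factor [2 `^ q], obtained by taking [lam] to be the
    q-th root of [Y] in [mean_dist_lam]. *)
Lemma mean_dist_le : `|m - mean B w| `^ q <= 2 `^ q * Y.
Proof.
have [Y00|Y00] := eqVneq Y 0.
  suff -> : `|m - mean B w| = 0 by rewrite powR0 ?gt_eqF// Y00 mulr0.
  apply/eqP; rewrite eq_le normr_ge0 andbT; apply/ler_addgt0Pr => e e0.
  by have := mean_dist_lam e0; rewrite Y00 mul0r addr0 add0r.
have Yp : 0 < Y by rewrite lt_neqAle eq_sym Y00.
have lp : 0 < Y `^ q^-1 by exact: powR_gt0.
have := mean_dist_lam lp.
have -> : Y * Y `^ q^-1 `^ (1 - q) = Y `^ q^-1.
  rewrite -powRrM -{1}(powRr1 Y0) -powRD ?Y00 ?implybT//; congr (_ `^ _).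
  by field; rewrite gt_eqF.
move=> H0; have {H0}H : `|m - mean B w| <= 2 * Y `^ q^-1 by lra.
apply: (@le_trans _ _ ((2 * Y `^ q^-1) `^ q)).
  apply: ge0_ler_powR; rewrite ?nnegrE ?(ltW q0)//.
  by apply: mulr_ge0; [exact: ler0n|exact: ltW].
by rewrite powRM ?(ltW lp)// -powRrM mulVf ?gt_eqF// powRr1.
Qed.

Lemma mean_Lq :
  (\int[leb n]_(x in B) (`|w x - mean B w| `^ q)%:E <= (4 `^ q * (vol B * Y))%:E)%E.
Proof.
set a := mean B w; have q1' : 1 <= q by exact: ltW.
have mgq : measurable_fun B (fun x => (g x `^ q)%:E).
  apply/measurable_EFinP; apply: measurable_funTS.
  exact: (measurableT_comp (measurable_powR _)).
apply: (@le_trans _ _ (\int[leb n]_(x in B)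
   ((2 `^ (q - 1))%:E * ((g x `^ q)%:E + (2 `^ q * Y)%:E)))%E).
  apply: le_integral_nomeas => x _; first by rewrite lee_fin powR_ge0.
  rewrite -EFinD -EFinM lee_fin.
  have := norm_powRD_le (w x - m) (m - a) q1'; rewrite addrA subrK => /le_trans; apply.
  by rewrite ler_wpM2l ?powR_ge0// lerD2l mean_dist_le.
have c0 : 0 <= 2 `^ q * Y by rewrite mulr_ge0 ?powR_ge0.
rewrite ge0_integralZl//; last 2 first.
- by apply: emeasurable_funD.
- by move=> x _; rewrite -EFinD lee_fin addr_ge0 ?powR_ge0.
rewrite ge0_integralD//; last by move=> x _; rewrite lee_fin powR_ge0.
rewrite intcst.
apply: (@le_trans _ _ ((2 `^ (q - 1))%:E * ((vol B * Y)%:E + (2 `^ q * Y * vol B)%:E))%E).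
  by apply: lee_wpmul2l; [rewrite lee_fin powR_ge0|rewrite leeD2r].
rewrite -EFinD -EFinM lee_fin.
have -> : 4 = 2 * 2 :> R by rewrite -natrM.
rewrite powRM// powRB ?pnatr_eq0 ?implybT// powRr1//.
have t1 : 1 <= 2 `^ q :> R by rewrite -[leLHS](powRr0 2); apply: ler_powR; [rewrite ler1n|exact: ltW].
set t := 2 `^ q in t1 *.
have VY0 : 0 <= vol B * Y by rewrite mulr_ge0// ltW.
rewrite [leLHS](_ : _ = t * ((1 + t) / 2) * (vol B * Y)); last by ring.
by rewrite ler_wpM2r// ler_wpM2l//; lra.
Qed.

End mean_oscillation.

(** * The Sobolev-Poincare inequality *)

Section energy_comparison.
Context {R : realType} {n : nat}.
Variables (x0 : n.-tuple R) (r s p L : R) (phi : R -> R).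
Hypotheses (n0 : (0 < n)%N) (r0 : 0 < r).
Hypotheses (s0 : 0 < s) (s1 : s < 1) (p1 : 1 < p) (L1 : 1 <= L).
Hypothesis phi00 : phi 0 = 0.
Hypothesis phi_gt0 : forall t, 0 < t -> 0 < phi t.
Hypothesis ad : adec s p L phi.

Local Notation B := (eball x0 r).

Lemma edist_eq0 (x y : n.-tuple R) : edist x y = 0 -> x = y.
Proof.
move=> /eqP; rewrite sqrtr_eq0 => H; apply: eq_from_tnth => i.
apply/eqP; rewrite -subr_eq0 -sqrf_eq0 eq_le sqr_ge0 andbT.
by apply: le_trans H; rewrite (bigD1 i)//= lerDl sumr_ge0// => j _; rewrite sqr_ge0.
Qed.

Let C : R := 2 * L * (2 * r) `^ (n%:R + p).

Let C0 : 0 < C.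
Proof. by rewrite mulr_gt0 ?powR_gt0 ?mulr_gt0// (lt_le_trans _ L1). Qed.

(** The kernel of the energy is bounded from below by the Borel kernel of
    [multiscale_le] before any use of additivity, and [v] is replaced by [w] off the
    null set in each variable. *)
Lemma kenergy_le_energy (v w : n.-tuple R -> R) (N0 : set (n.-tuple R)) (N : nat) :
  measurable N0 -> leb n N0 = 0%E -> measurable_fun setT w ->
  (forall x, B x -> ~ N0 x -> v x = w x) ->
  ((C^-1)%:E * kenergy x0 r p (multiscale (n := n) r p (fun k => phi (tau r k)) N) w <=
   energy phi p B v)%E.
Proof.
move=> mN N00 mw vw.
have phi_ge0 d : 0 <= d -> 0 <= phi d.
  by rewrite le_eqVlt => /predU1P[<-|/phi_gt0/ltW//]; rewrite phi00.
have f0 k : 0 <= phi (tau r k) by rewrite ltW// phi_gt0// tau_gt0.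
set kap := multiscale r p _ N.
have kap0 d : 0 <= kap d by exact: multiscale_ge0.
have mkap : measurable_fun setT kap by exact: measurable_multiscale.
have Ci0 : 0 <= C^-1 by rewrite invr_ge0 ltW.
have K0 x y : 0 <= kform x0 r p kap w x y by exact: kform_ge0.
rewrite -dintZ//; last exact: mfun2_kform.
pose F x y := C^-1 * kform x0 r p kap w x y.
have F0 x y : 0 <= F x y by exact: mulr_ge0.
pose G x y := \1_(~` N0) x * \1_(~` N0) y * F x y.
have G0 x y : 0 <= G x y by rewrite !mulr_ge0.
have -> : dint (leb n) F = dint (leb n) G.
  apply: (eq_integral_off_null mN N00) => x _ Nx.
  apply: (eq_integral_off_null mN N00) => y _ Ny.
  by rewrite /G !indicE !mem_set// !mul1r.
pose e x y : R := `|v x - v y| `^ p / edist x y `^ p * (phi (edist x y) / edist x y ^+ n).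
have e0 x y : 0 <= e x y.
  by rewrite mulr_ge0 ?divr_ge0 ?powR_ge0 ?exprn_ge0 ?edist_ge0 ?phi_ge0 ?edist_ge0.
have Ge x y : B x -> B y -> G x y <= e x y.
  move=> Bx By; have [Nx|Nx] := pselect (N0 x).
    by rewrite /G indicE memNset ?mul0r//; exact.
  have [Ny|Ny] := pselect (N0 y).
    by rewrite /G [\1__ y]indicE (@memNset _ _ y) ?mulr0 ?mul0r//; exact.
  rewrite /G /F /kform !indicE !mem_set// !mul1r -vw// -vw// ler_pdivrMl//.
  have := edist_ge0 x y; rewrite le_eqVlt => /predU1P[d0|d0].
    have -> : x = y by exact: edist_eq0.
    rewrite subrr normr0 powR0; last by rewrite gt_eqF// (lt_trans _ p1).
    by rewrite mulr0 mulr_ge0// ltW.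
  apply: le_trans (ler_wpM2r (powR_ge0 _ _)
    (multiscale_le s0 p1 L1 r0 phi_gt0 ad N n0 d0)) _.
  by rewrite /e le_eqVlt; apply/orP; left; apply/eqP; rewrite /C; ring.
rewrite /energy integral_mkcond /dint; apply: le_integral_nomeas => x _.
  by apply: integral_ge0 => y _; rewrite lee_fin.
rewrite patchE; case: ifPn => [/set_mem Bx|Bx]; last first.
  rewrite (eq_integral (fun=> 0%E)) ?integral0// => y _.
  by rewrite /G /F /kform [\1__ x in X in _ * X]indicE (negbTE Bx) !mul0r !mulr0.
rewrite [leRHS]integral_mkcond; apply: le_integral_nomeas => y _; first by rewrite lee_fin.
rewrite patchE; case: ifPn => [/set_mem By|By]; first by rewrite lee_fin Ge.
rewrite /G /F /kform [X in _ * (_ * X * _)]indicE (negbTE By) !(mulr0, mul0r)//.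
Qed.

End energy_comparison.

Section final_constant.
Context {R : realType}.
Variables (p nn : R).
Hypotheses (p1 : 1 < p) (nn1 : 1 <= nn).

Definition gap_const : R := ln 2 / (p * (1 + nn)).

Let ln20 : 0 < ln 2 :> R. Proof. by rewrite ln_gt0// ltr1n. Qed.
Let p0 : 0 < p. Proof. exact: lt_trans p1. Qed.

Lemma gap_const_gt0 : 0 < gap_const.
Proof. by rewrite divr_gt0// mulr_gt0// addr_gt0// (lt_le_trans _ nn1). Qed.

(** The gap [1 - theta] of the Hardy inequality is of order [e], uniformly for
    [e <= nn]. *)
Lemma gap_le e : 0 < e -> e <= nn -> gap_const * e <= 1 - 2 `^ (- (e / p)).
Proof.
move=> e0 en; have w0 : 0 <= e / p by rewrite divr_ge0// ltW.
apply: le_trans (one_sub_powR2 w0).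
have ln21 : ln 2 <= 1 :> R.
  by have := @le_ln1Dx R 1; rewrite (_ : 1 + 1 = 2)//; apply; lra.
have w1 : e / p * ln 2 <= nn.
  apply: (@le_trans _ _ (nn * 1)); last by rewrite mulr1.
  apply: ler_pM => //; [exact: ltW|rewrite ler_pdivrMr//].
  by apply: le_trans en _; rewrite ler_peMr ?ltW// (lt_le_trans _ nn1).
rewrite /gap_const.
have w2 : 0 <= e / p * ln 2 by rewrite mulr_ge0// ltW.
have -> : ln 2 / (p * (1 + nn)) * e = e / p * ln 2 / (1 + nn).
  by field; rewrite !gt_eqF//; lra.
by rewrite ler_wpM2l// lef_pV2 ?posrE; lra.
Qed.

Definition sobolev_const : R :=
  4 `^ p * gap_const `^ (1 - p) * expR ((gap_const * nn)^-1).

Lemma sobolev_const_gt0 : 0 < sobolev_const.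
Proof. by rewrite !mulr_gt0 ?powR_gt0 ?expR_gt0 ?gap_const_gt0. Qed.

(** The main factor is [(1 - theta) `^ (1 - p)], of order [e `^ (1 - p)]. The other
    one is [(1 - theta)^-1] to the power [p / q = e / nn], which stays bounded by
    [powR_inv_le]. *)
Lemma sobolev_const_bound e (q := nn * p / e) (theta := 2 `^ (- (e / p))) Z :
  0 < e -> e <= nn -> 0 <= Z ->
  (4 `^ q * (((1 - theta) `^ (1 - p) * Z) `^ (q / p) / (1 - theta))) `^ (p / q) <=
  sobolev_const / e `^ (p - 1) * Z.
Proof.
move=> e0 en Z0; have nn0 : 0 < nn by exact: lt_le_trans nn1.
have q0 : 0 < q by rewrite divr_gt0// mulr_gt0.
have g0 := gap_const_gt0.
have ge0 : 0 < gap_const * e by rewrite mulr_gt0.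
have gth : gap_const * e <= 1 - theta by exact: gap_le.
have th0 : 0 < 1 - theta by exact: lt_le_trans gth.
have pqE : p / q = e / nn by rewrite /q; field; rewrite !gt_eqF.
rewrite powRM ?powR_ge0 ?divr_ge0 ?powR_ge0 ?(ltW th0)//.
rewrite -powRrM (mulrC q) divfK ?gt_eqF// powRM ?powR_ge0 ?invr_ge0 ?(ltW th0)//.
rewrite -powRrM (_ : q / p * (p / q) = 1); last by field; rewrite !gt_eqF.
rewrite powRr1 ?mulr_ge0 ?powR_ge0//.
have H1 : (1 - theta) `^ (1 - p) <= gap_const `^ (1 - p) / e `^ (p - 1).
  rewrite -powRN opprB -powRM ?(ltW g0) ?(ltW e0)// -(opprB p 1) !powRN.
  rewrite lef_pV2 ?posrE ?powR_gt0//.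
  apply: ge0_ler_powR; rewrite ?nnegrE ?(ltW ge0) ?(ltW th0)//.
  by rewrite subr_ge0 ltW.
have H2 : (1 - theta)^-1 `^ (p / q) <= expR ((gap_const * nn)^-1).
  apply: (@le_trans _ _ ((gap_const * e)^-1 `^ (p / q))).
    apply: ge0_ler_powR; rewrite ?nnegrE ?invr_ge0 ?(ltW ge0) ?(ltW th0)//.
      by rewrite divr_ge0 ?(ltW p0) ?(ltW q0).
    by rewrite lef_pV2 ?posrE.
  have pq0 : 0 <= p / q by rewrite divr_ge0 ?(ltW p0) ?(ltW q0).
  have ei0 : 0 < (gap_const * e)^-1 by rewrite invr_gt0.
  apply: le_trans (powR_inv_le ei0 pq0) _.
  rewrite ler_expR pqE le_eqVlt; apply/orP; left; apply/eqP.
  by field; rewrite !gt_eqF.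
rewrite /sobolev_const; move: H1 H2; set ex := expR _; set gp := gap_const `^ _ => H1 H2.
rewrite [leRHS](_ : _ = 4 `^ p * (gp / e `^ (p - 1) * Z * ex)); last by ring.
apply: ler_wpM2l; first exact: powR_ge0.
apply: ler_pM => //; rewrite ?mulr_ge0 ?powR_ge0//.
by rewrite ler_wpM2r.
Qed.

End final_constant.

Definition energy_const {R : realType} (n : nat) (p L : R) : R :=
  16 * L ^+ 3 * 2 ^+ n * 4 `^ p * n%:R ^+ n.

(** One factor [V^-1] is absorbed by [r ^+ n], since the ball contains a cube with
    side [2 * (r / n)]; the other one is the average in the statement. *)
Lemma energy_const_bound (R : realType) (n : nat) (p L r V S Ph E0 : R) :
  (0 < n)%N -> 1 < p -> 1 <= L -> 0 < r -> 0 < Ph -> 0 <= E0 ->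
  (2 * (r / n%:R)) ^+ n <= V -> Ph <= 2 * L * 2 `^ p * S ->
  (2 * L * (2 * r) `^ (n%:R + p) * E0) / ((V / 2) ^+ 2 / 2 ^+ n * L^-1 * S) <=
  energy_const n p L * (r `^ p / Ph) * (V^-1 * E0).
Proof.
move=> n0 p1 L1 r0 Ph0 E00 VV PS.
have L0 : 0 < L by exact: lt_le_trans L1.
have tp0 : 0 < 2 `^ p by exact: powR_gt0.
have S0 : 0 < S.
  have : 0 < 2 * L * 2 `^ p * S by exact: lt_le_trans PS.
  by rewrite pmulr_rgt0// !mulr_gt0.
have nn0 : 0 < n%:R :> R by rewrite ltr0n.
have b0 : 0 < (2 * (r / n%:R)) ^+ n by rewrite exprn_gt0// mulr_gt0// divr_gt0.
have V0 : 0 < V by exact: lt_le_trans VV.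
have Vi : V^-1 <= ((2 * (r / n%:R)) ^+ n)^-1 by rewrite lef_pV2 ?posrE.
have Si : S^-1 <= 2 * L * 2 `^ p / Ph.
  by rewrite ler_pdivlMr// mulrC ler_pdivrMr// mulrC.
have r2 : 0 < 2 * r by rewrite mulr_gt0.
have rn0 : 0 < r ^+ n by rewrite exprn_gt0.
have tn0 : 0 < 2 ^+ n :> R by rewrite exprn_gt0.
have nnn0 : 0 < n%:R ^+ n :> R by rewrite exprn_gt0.
have rp0 : 0 < r `^ p by exact: powR_gt0.
rewrite powRD ?(gt_eqF r2) ?implybT// powR_mulrn ?(ltW r2)// powRM ?(ltW r0)//.
have e4 : 4 `^ p = 2 `^ p * 2 `^ p :> R by rewrite -powRM//; congr (_ `^ _); rewrite -natrM.
rewrite [leLHS](_ : _ = (8 * L ^+ 2 * 2 ^+ n * (2 * r) ^+ n * (2 `^ p * r `^ p) * E0 * V^-1) * (V^-1 * S^-1)); last first.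
  by field; rewrite !gt_eqF.
apply: (@le_trans _ _ ((8 * L ^+ 2 * 2 ^+ n * (2 * r) ^+ n * (2 `^ p * r `^ p) * E0 * V^-1) *
   (((2 * (r / n%:R)) ^+ n)^-1 * (2 * L * 2 `^ p / Ph)))).
  apply: ler_wpM2l.
    by rewrite !mulr_ge0 ?exprn_ge0 ?powR_ge0 ?invr_ge0 ?(ltW L0) ?(ltW V0) ?(ltW r2)// mulr_ge0 ?(ltW r0).
  by apply: ler_pM => //; rewrite invr_ge0 ltW.
rewrite le_eqVlt; apply/orP; left; apply/eqP.
rewrite /energy_const e4 !exprMn exprVn; field.
by rewrite !gt_eqF.
Qed.

Theorem theorem3p1 (R : realType) (n : nat) (p st L : R) :
  1 < p -> 1 <= L ->
  exists2 c : R, 0 < c &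
    forall (s : R) (phi : R -> R),
      0 < s -> s < 1 -> s * p < n%:R -> s < st ->
      weight phi -> Dini phi -> adec s p L phi -> ainc st p L phi ->
    forall (x0 : n.-tuple R) (r : R) (v : n.-tuple R -> R),
      0 < r -> W phi p (eball x0 r) v ->
      let B := eball x0 r in
      let pstar := n%:R * p / (n%:R - s * p) in
      (((vol B)^-1%:E *
         \int[leb n]_(x in B) (`|v x - mean B v| `^ pstar)%:E) `^ (p / pstar)
       <= (c / (s `^ p * (n%:R - s * p) `^ (p - 1)) * (r `^ p / Phi phi r))%:E *
          ((vol B)^-1%:E * energy phi p B v))%E.
Proof.
move=> p1 L1; have p0 : 0 < p by exact: lt_trans p1.
have L0 : 0 < L by exact: lt_le_trans L1.
case: (posnP n) => [n0|n0].
  exists 1 => // s phi s0 _; rewrite n0 => sp0.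
  by have := lt_trans (mulr_gt0 s0 p0) sp0; rewrite ltxx.
have nn0 : 0 < n%:R :> R by rewrite ltr0n.
have nn1 : 1 <= n%:R :> R by rewrite ler1n.
exists (sobolev_const p n%:R * energy_const n p L).
  rewrite mulr_gt0 ?sobolev_const_gt0// /energy_const.
  by rewrite !mulr_gt0 ?exprn_gt0 ?powR_gt0.
move=> s phi s0 s1 spn _ [_ phi00 phi_gt0] din ad _ x0 r v r0 vW; cbv zeta.
set B := eball x0 r; set q := n%:R * p / _.
have [[mv _] Efin] := vW.
set e := n%:R - s * p.
have e0 : 0 < e by rewrite subr_gt0.
have en : e <= n%:R by rewrite gerBl mulr_ge0 ?ltW.
have mB : measurable B by exact: measurable_eball.
have Boo : (leb n B < +oo)%E by exact: leb_eball_lty.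
have V0 : 0 < vol B by exact: vol_gt0.
have [N0 [w [mN N00 mw vw]]] := borel_representative mB mv.
have -> : mean B v = mean B w.
  rewrite /mean /Rintegral; congr (_ * fine _).
  by apply: (eq_integral_off_null mN N00) => x Bx Nx; rewrite vw.
have -> : (\int[leb n]_(x in B) (`|v x - mean B w| `^ q)%:E =
    \int[leb n]_(x in B) (`|w x - mean B w| `^ q)%:E)%E.
  by apply: (eq_integral_off_null mN N00) => x Bx Nx; rewrite vw.
have phi_ge0 d : 0 <= d -> 0 <= phi d.
  by rewrite le_eqVlt => /predU1P[<-|/phi_gt0/ltW//]; rewrite phi00.
have En0 : (0 <= energy phi p B v)%E.
  apply: integral_ge0 => x _; apply: integral_ge0 => y _.
  by rewrite lee_fin mulr_ge0 ?divr_ge0 ?powR_ge0 ?exprn_ge0 ?edist_ge0 ?phi_ge0 ?edist_ge0.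
have EnE : energy phi p B v = (fine (energy phi p B v))%:E.
  by rewrite fineK// ge0_fin_numE.
rewrite EnE; set E0 := fine _.
have E00 : 0 <= E0 by exact: fine_ge0.
have [M [Ph0 PhM]] := Phi_bound s0 s1 p1 L1 r0 phi_gt0 ad din.
pose f k := phi (tau r k).
have f0 k : 0 <= f k by rewrite ltW// phi_gt0// tau_gt0.
have SM : 0 < \sum_(k < M) f k.
  have : 0 < 2 * L * 2 `^ p * \sum_(k < M) f k by exact: lt_le_trans PhM.
  by rewrite pmulr_rgt0// !mulr_gt0 ?powR_gt0.
pose rho := 2 `^ (- ((1 - s) * p)).
pose theta := 2 `^ (- (e / p)).
have ep0 : 0 < e / p by rewrite divr_gt0.
have th01 : 0 < theta < 1.
  rewrite powR_gt0//= /theta powRN invf_lt1 ?powR_gt0//.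
  rewrite [ltLHS](_ : 1 = 1 `^ (e / p)); last by rewrite powR1.
  by rewrite gt0_ltr_powR ?nnegrE ?ltr1n.
have thp : theta `^ p = 2 `^ p * rho / 2 ^+ n.
  rewrite /theta -powRrM -powR_mulrn// -powRN /rho -!powRD ?pnatr_eq0 ?implybT//.
  by congr (_ `^ _); rewrite /e; field; rewrite gt_eqF.
have thq : theta `^ q = (2 ^+ n)^-1.
  rewrite /theta -powRrM -powR_mulrn// -powRN; congr (_ `^ _).
  by rewrite /q -/e; field; rewrite !gt_eqF.
have pq : p <= q by rewrite /q -/e ler_pdivlMr// mulrC ler_wpM2r// ltW.
have frho i k : L^-1 * rho ^+ i * f k <= f (i + k)%N by exact: phi_tauD.
set C := 2 * L * (2 * r) `^ (n%:R + p).
have C0 : 0 < C by rewrite !mulr_gt0 ?powR_gt0 ?mulr_gt0.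
have kE N : (kenergy x0 r p (multiscale (n := n) r p f N) w <= (C * E0)%:E)%E.
  have := kenergy_le_energy n0 r0 s0 p1 L1 phi00 phi_gt0 ad N mN N00 mw vw.
  by rewrite EnE -/C lee_pdivrMl// -EFinM.
have Li0 : 0 < L^-1 by rewrite invr_gt0.
have rho0 : 0 <= rho by exact: powR_ge0.
have [m Hm] := median_Lq n0 r0 p1 pq Li0 rho0 f0 frho SM th01 thp thq mw kE.
set F := energy_factor _ _ _ _ _ _ _ _ _ in Hm.
have th10 : 0 < 1 - theta by have /andP[_] := th01; rewrite subr_gt0.
have F0 : 0 <= F by rewrite divr_ge0 ?powR_ge0// ltW.
have q1 : 1 < q by exact: lt_le_trans pq.
have q0 : 0 < q by exact: lt_trans q1.
have Hmean := mean_Lq mB V0 Boo q1 F0 mw Hm.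
set I := (\int[leb n]_(x in B) _)%E in Hmean *.
have I0 : (0 <= I)%E by apply: integral_ge0 => x _; rewrite lee_fin powR_ge0.
have Vi0 : 0 <= (vol B)^-1 by rewrite invr_ge0 ltW.
have pq0 : 0 <= p / q by rewrite divr_ge0 ?ltW.
have avg : ((vol B)^-1%:E * I <= (4 `^ q * F)%:E)%E.
  apply: (@le_trans _ _ ((vol B)^-1%:E * (4 `^ q * (vol B * F))%:E)%E).
    by apply: lee_wpmul2l; rewrite ?lee_fin.
  by rewrite -EFinM lee_fin mulrCA mulKf ?gt_eqF.
apply: (@le_trans _ _ ((4 `^ q * F)%:E `^ (p / q))%E).
  apply: gt0_ler_poweR => //; rewrite in_itv/= leey andbT.
    by rewrite mule_ge0.
  by rewrite lee_fin mulr_ge0 ?powR_ge0.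
rewrite poweR_EFin -!EFinM lee_fin.
set X := (C * E0) / ((vol B / 2) ^+ 2 / 2 ^+ n * L^-1 * \sum_(k < M) f k).
have X0 : 0 <= X.
  apply: divr_ge0; first by apply: mulr_ge0 => //; exact: ltW.
  apply: ltW; rewrite mulr_gt0// mulr_gt0// mulr_gt0 ?invr_gt0 ?exprn_gt0//.
  exact: divr_gt0.
have := sobolev_const_bound p1 nn1 e0 en X0; rewrite -/q -/theta -/F.
move=> /le_trans; apply.
have Vb : (2 * (r / n%:R)) ^+ n <= vol B.
  by rewrite -lee_fin -leb_ball//; exact: leb_eball_ge.
have XK := energy_const_bound n0 p1 L1 r0 Ph0 E00 Vb PhM.
have sc0 : 0 < sobolev_const p n%:R by exact: sobolev_const_gt0.
have ep10 : 0 < e `^ (p - 1) by exact: powR_gt0.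
have sp0 : 0 < s `^ p by exact: powR_gt0.
have sp1 : s `^ p <= 1.
  rewrite [leRHS](_ : 1 = 1 `^ p); last by rewrite powR1.
  by apply: ge0_ler_powR; rewrite ?nnegrE ?(ltW p0) ?(ltW s0) ?(ltW s1).
apply: (@le_trans _ _ (sobolev_const p n%:R / e `^ (p - 1) *
   (energy_const n p L * (r `^ p / Phi phi r) * ((vol B)^-1 * E0)))).
  by apply: ler_wpM2l => //; rewrite divr_ge0 ?ltW.
rewrite [leRHS](_ : _ = (s `^ p)^-1 * (sobolev_const p n%:R / e `^ (p - 1) *
   (energy_const n p L * (r `^ p / Phi phi r) * ((vol B)^-1 * E0)))); last first.
  by field; rewrite !gt_eqF.
rewrite ler_peMl//; last by rewrite invf_ge1.
apply: mulr_ge0; first by rewrite divr_ge0 ?ltW.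
exact: le_trans X0 XK.
Qed.
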